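(* Let $\varepsilon>0$. For Lebesgue almost every $\alpha\in[0,1]$ the following holds: for every compactly supported continuous function $g:\mathbb{R}^2\to[0,1]$ and every $\delta>0$ there exists $N_0=N_0(\alpha,\varepsilon,g,\delta)$ such that for all integers $N\geqslant N_0$ and all real $L$ with $N^{1/4+\varepsilon}<L<N^{1-\varepsilon}$, \[ R_3(\alpha,L,N,g)=(1+\theta)\,L^2\int_{\mathbb{R}^2} g(\mathbf{w})\,d\mathbf{w}\quad\text{for some } |\theta|\leqslant\delta. \]
   Context: For $x\in\mathbb{R}$, $\{x\}_{\mathrm{sgn}}\in(-1/2,1/2]$ denotes the signed distance from $x$ to the nearest integer (i.e. the unique element of $(-1/2,1/2]$ congruent to $x$ mod $1$). For $\alpha\in[0,1]$, $k\geqslant2$, a compactly supported $g:\mathbb{R}^{k-1}\to[0,1]$, $N\in\mathbb{N}$ and real $L>0$, the $k$-th correlation function is \[ R_k(\alpha,L,N,g)=\frac1N\sum_{\substack{1\leqslant x_1,\dots,x_k\leqslant N\\ \text{distinct}}} g\Big(\tfrac NL\{\alpha(x_1^2-x_2^2)\}_{\mathrm{sgn}},\dots,\tfrac NL\{\alpha(x_{k-1}^2-x_k^2)\}_{\mathrm{sgn}}\Big), \] the sum being over integers. *)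

(* Defs.v *)
From HB Require Import structures.
From mathcomp Require Import all_boot all_order all_algebra.
From mathcomp Require Import all_classical all_reals all_analysis.
From mathcomp Require Import lra.

Set Implicit Arguments.
Unset Strict Implicit.
Unset Printing Implicit Defensive.

Import Order.TTheory GRing.Theory Num.Theory.
Import numFieldNormedType.Exports.

Local Open Scope classical_set_scope.
Local Open Scope ring_scope.

(* Subtracting ceil (x - 1/2), rather than floor (x + 1/2), is what makes the
   interval of values open at -1/2 and closed at 1/2. *)
Definition sgn_frac (R : realType) (x : R) : R :=
  x - (Num.ceil (x - 2^-1))%:~R.

Lemma sgn_frac_itv (R : realType) (x : R) : - 2^-1 < sgn_frac x <= 2^-1.
Proof.
rewrite /sgn_frac; have := ceil_itv (x - 2^-1).
by rewrite intrB => /andP[? ?]; apply/andP; split; lra.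
Qed.

Lemma sgn_frac_unique (R : realType) (x y : R) (m : int) :
  - 2^-1 < y <= 2^-1 -> x = y + m%:~R -> y = sgn_frac x.
Proof.
move=> /andP[ylo yhi] xE; rewrite /sgn_frac (@ceil_def _ _ m).
  by rewrite xE addrK.
by rewrite intrB xE; apply/andP; split; lra.
Qed.

(* A tuple (x_1, ..., x_k) of distinct integers in [1, N] is a duplicate-free
   k-tuple over 'I_N.+1 = {0, ..., N} that avoids 0. Positions are numbered
   from 0, so the j-th argument of g (0 <= j < k - 1) involves the entries at
   positions j and j + 1, both below k. *)
Definition correlation (R : realType) (k : nat) (alpha L : R) (N : nat)
    (g : 'rV[R]_k.-1 -> R) : R :=
  N%:R^-1 *
  \sum_(x : k.-tuple 'I_N.+1 | uniq x && all (fun i : 'I_N.+1 => 1 <= i)%N x)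
    g (\row_(j < k.-1)
         (N%:R / L *
          sgn_frac (alpha * ((nth ord0 x j)%:R ^+ 2
                             - (nth ord0 x j.+1)%:R ^+ 2)))).

Definition compactly_supported (T : topologicalType) (R : realType)
    (g : T -> R) : Prop :=
  compact (closure [set w | g w != 0]).

(* Main.v *)
Require Import Defs.
From mathcomp Require Import all_boot all_order all_algebra.
From mathcomp Require Import all_classical all_reals all_analysis.
From mathcomp Require Import measurable_realfun complex lra ring zify.
Set Implicit Arguments.
Unset Strict Implicit.
Unset Printing Implicit Defensive.
Import Order.TTheory GRing.Theory Num.Theory.
Import numFieldNormedType.Exports.
Import ComplexField.Normc.
Local Open Scope classical_set_scope.
Local Open Scope ring_scope.

(* Write F(m) for the sum of e(m alpha x^2) over 1 <= x <= N. By orthogonality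
   |F(m)|^2 has mean N over alpha, so Markov's inequality, a Rademacher-Menshov
   maximal inequality over N and Borel-Cantelli show that, for almost every
   alpha, the sum of |F(m)|^2 / m over 1 <= m < N^4 is at most N times a power
   of log N for all large N.
   This single estimate suffices. For an interval J put
   S(y) = #{x <= N : (N / L) {alpha (x^2 - y^2)} in J}. Sandwiching the
   indicator of J between sums of shifted Fejer kernels expands S(y) - L |J|
   into a sum over m of c_m F(m) e(- m alpha y^2), where |c_m| is at most
   2 / m and O(L / N). Squaring and summing over y gives a sum over m, k of
   |c_m c_k F(m) F(k) F(m - k)|. The terms m = k contribute
   O(L N^(1 + o(1))); for k < m the bound 2 F(m) F(m - k) <= F(m)^2 + F(m - k)^2
   and 1 / m <= 1 / (m - k) give O(N^(3/2 + o(1))). Both are o(N L^2) exactly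
   because L > N^(1/4 + eps).
   By Cauchy-Schwarz the sum over y of S_I(y) S_J(y) is asymptotic to
   N L^2 |I| |J|, and g is approximated by step functions on a grid of
   squares. *)

(** * The trilinear bound for exponential sums *)

(** Once the middle point y is fixed, the sums over x and z decouple, so a triple sum over a product
    of windows is a sum over y of a product of two counts. Bounding the variance of each count is
    therefore enough. The result must hold for all real L in the range and all g at once, while null
    sets may be discarded only countably often. Hence the coefficient bound 2 / m is uniform in the
    position and length of the window, and the only quantity controlled for almost every alpha is an
    energy indexed by a dyadic exponent; the rest is deterministic. The cutoff N^4 comes from
    smoothing the windows at scale 1 / N: a kernel of degree Q then leaks at most 4 N^2 / Q per
    point, that is 4 / N over N points. In the bound N^(3/2 + o(1)) one factor is the energy, of
    size N, and the other is the sum of |F(k)| / k, of size sqrt N, both up to powers of log N.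
    Triples with a coincidence reduce to pair sums of size O(N L), negligible since L tends to
    infinity. *)

Lemma sum_ltn_shift_le (R : realFieldType) (f : nat -> R) (Q k : nat) :
  (forall i, 0 <= f i) ->
  \sum_(m < Q | (k < m)%N) f (m - k)%N <= \sum_(m < Q) f m.
Proof.
move=> f0; rewrite -!(big_mkord xpredT) -(big_mkord (fun m => k < m)%N (fun m => f (m - k)%N)).
have [kQ|Qk] := leqP k Q; last first.
  rewrite big_nat_cond big_pred0 ?sumr_ge0// => i; apply/negP => /andP[/andP[_ iQ]] ki.
  by move: (ltn_trans ki iQ); rewrite ltnNge (ltnW Qk).
rewrite (big_cat_nat (leq0n k) kQ)/= big_nat_cond big_pred0 ?add0r; last first.
  by move=> i; apply/negP => /andP[/andP[_ ik]]; rewrite ltnNge (ltnW ik).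
rewrite -{1}(add0n k) big_addn.
apply: (le_trans (y := \sum_(0 <= i < Q - k) f i)).
  rewrite big_mkcond/=; apply: ler_sum_nat => i _; case: ifP => _ //.
  by rewrite addnK.
rewrite [leRHS](big_cat_nat (leq0n (Q - k)) (leq_subr k Q))/= lerDl.
by apply: sumr_ge0.
Qed.

(** For fixed [k], each of the two sums over [m] is at most the full energy, the second because
    [m - k] takes each value at most once. *)
Lemma trilinear_half (R : realFieldType) (f : nat -> R) (Q : nat) :
  (forall i, 0 <= f i) ->
  \sum_(k < Q) \sum_(m < Q | (k < m)%N)
     (f k / k%:R * (f m ^+ 2 / m%:R + f (m - k)%N ^+ 2 / (m - k)%N%:R)) <=
  2 * (\sum_(k < Q) f k / k%:R) * \sum_(k < Q) f k ^+ 2 / k%:R.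
Proof.
move=> f0; rewrite mulrAC mulr_sumr; apply: ler_sum => k _.
rewrite -mulr_sumr mulrC ler_wpM2r ?divr_ge0//.
rewrite big_split/= [leRHS]mulr_natl mulr2n lerD//.
  rewrite big_mkcond/=; apply: ler_sum => m _; case: ifP => // _.
  by rewrite divr_ge0// exprn_ge0.
by apply: (@sum_ltn_shift_le _ (fun i => f i ^+ 2 / i%:R)) => i; rewrite divr_ge0// exprn_ge0.
Qed.

(** This is |m - k|: subtraction is truncated, so at least one of the two differences is zero. *)
Definition gap (m k : nat) : nat := ((m - k) + (k - m))%N.

(** Here [a] and [f] stand for the moduli of the coefficients and of the exponential sums. On the
    diagonal one factor [a] is bounded by [kap] and the other by 2 / i; off the diagonal both are
    bounded by the decaying estimate, and symmetry reduces to [k < m]. *)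
Lemma trilinear_bound (R : realFieldType) (f a : nat -> R) (Q : nat) (kap : R) :
  (forall i, 0 <= f i) -> (forall i, 0 <= a i) -> 
  (forall i, a i <= kap) -> (forall i, a i <= 2 / i%:R) ->
  \sum_(m < Q) \sum_(k < Q) (a m * f m * (a k * f k)) * f (gap m k) <=
  2 * kap * f 0%N * (\sum_(k < Q) f k ^+ 2 / k%:R)
  + 8 * (\sum_(k < Q) f k / k%:R) * \sum_(k < Q) f k ^+ 2 / k%:R.
Proof.
move=> f0 a0 akap a2.
set G := \sum_(k < Q) f k ^+ 2 / k%:R; set S := \sum_(k < Q) f k / k%:R.
pose T (m k : nat) := (a m * f m * (a k * f k)) * f (gap m k).
have T0 m k : 0 <= T m k by rewrite /T !mulr_ge0.
have key (k m : nat) : (k < m)%N -> 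
   T m k <= 2 * (f k / k%:R * (f m ^+ 2 / m%:R + f (m - k)%N ^+ 2 / (m - k)%N%:R)).
  move=> km; rewrite /T /gap (eqP (ltnW km)) addn0.
  have [->|k0] := posnP k.
    (* Since 2 / 0 is 0, the decay hypothesis forces [a 0 = 0]: the zero frequency never
       contributes. *)
    have := a2 0%N; rewrite invr0 mulr0 => a00.
    have -> : a 0%N = 0 by apply/eqP; rewrite eq_le a00 a0.
    by rewrite !(mul0r, mulr0).
  set d := (m - k)%N; have d0 : (0 < d)%N by rewrite subn_gt0.
  have dm : (d <= m)%N by rewrite leq_subr.
  have m0 : (0 < m)%N by apply: ltn_trans km.
  apply: (le_trans (y := 2 / m%:R * f m * (2 / k%:R * f k) * f d)).
    by rewrite ler_wpM2r// ler_pM ?mulr_ge0// ler_wpM2r.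
  have -> : 2 / m%:R * f m * (2 / k%:R * f k) * f d = 
      2 * (f k / k%:R * (m%:R^-1 * (2 * f m * f d))) by ring.
  rewrite ler_pM2l// ler_wpM2l ?divr_ge0//.
  apply: (le_trans (y := m%:R^-1 * (f m ^+ 2 + f d ^+ 2))).
    rewrite ler_wpM2l ?invr_ge0// -subr_ge0.
    have -> : f m ^+ 2 + f d ^+ 2 - 2 * f m * f d = (f m - f d) ^+ 2 by ring.
    exact: sqr_ge0.
  rewrite mulrDr mulrC lerD2l mulrC ler_wpM2l ?exprn_ge0//.
  by rewrite lef_pV2 ?posrE ?ltr0n// ler_nat.
have Tsym m k : T m k = T k m by rewrite /T /gap addnC; ring.
have split3 (m : 'I_Q) : \sum_(k < Q) T m k =
    \sum_(k < Q | (k < m)%N) T m k + T m m + \sum_(k < Q | (m < k)%N) T m k.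
  rewrite (bigID (fun k : 'I_Q => (k < m)%N))/= -addrA; congr (_ + _).
  rewrite (bigD1 m)/= ?ltnn//; congr (_ + _); apply: eq_bigl => k.
  by rewrite -leqNgt ltn_neqAle andbC eq_sym.
under eq_bigr do rewrite -/(T _ _).
rewrite (eq_bigr _ (fun m _ => split3 m)) !big_split/=.
have half : \sum_(i < Q) \sum_(k < Q | (i < k)%N) T i k <= 4 * S * G.
  have -> : 4 * S * G = 2 * (2 * S * G) by ring.
  apply: le_trans (ler_wpM2l (ler0n _ 2) (@trilinear_half _ f Q f0)).
  rewrite mulr_sumr; apply: ler_sum => k _; rewrite mulr_sumr.
  by apply: ler_sum => m km; rewrite Tsym key.
have half' : \sum_(i < Q) \sum_(k < Q | (k < i)%N) T i k <= 4 * S * G.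
  rewrite (exchange_big_dep xpredT)//=; apply: le_trans half.
  by apply: ler_sum => i _; apply: ler_sum => k _; rewrite Tsym.
have diag : \sum_(i < Q) T i i <= 2 * kap * f 0%N * G.
  rewrite mulr_sumr; apply: ler_sum => i _.
  rewrite /T /gap subnn addn0.
  have -> : a i * f i * (a i * f i) * f 0%N = a i * a i * (f 0%N * f i ^+ 2) by ring.
  have -> : 2 * kap * f 0%N * (f i ^+ 2 / i%:R) = kap * (2 / i%:R) * (f 0%N * f i ^+ 2) by ring.
  by rewrite ler_wpM2r ?mulr_ge0 ?exprn_ge0// ler_pM.
have := lerD (lerD half' diag) half; lra.
Qed.

Lemma normc_ge0 (R : rcfType) (z : R[i]) : 0 <= normc z.
Proof. by case: z => a b; apply: sqrtr_ge0. Qed.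

Lemma normrE_normc (R : rcfType) (z : R[i]) : `|z| = ((normc z)%:C)%C.
Proof. by case: z. Qed.

Lemma normcX (R : rcfType) (z : R[i]) n : normc (z ^+ n) = normc z ^+ n.
Proof. by elim: n => [|n IH]; rewrite ?expr0 ?normc1// !exprS normcM IH. Qed.

Lemma normc_sum_le (R : rcfType) (I : Type) (r : seq I) (P : pred I) (F : I -> R[i]) :
  normc (\sum_(i <- r | P i) F i) <= \sum_(i <- r | P i) normc (F i).
Proof.
elim/big_rec2 : _ => [|i y x _ IH]; first by rewrite normc0.
exact: le_trans (le_normcD _ _) (lerD _ IH).
Qed.

Lemma normc_conj (R : rcfType) (z : R[i]) : normc (conjc z) = normc z.
Proof. by case: z => a b /=; rewrite sqrrN. Qed.

Lemma normc_sqr_conj (R : rcfType) (z : R[i]) : (((normc z) ^+ 2)%:C)%C = z * conjc z.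
Proof. by rewrite rmorphXn/= -normrE_normc sqr_normc. Qed.

Lemma sqr_Re_le (R : rcfType) (z : R[i]) : complex.Re z ^+ 2 <= normc z ^+ 2.
Proof. by case: z => a b /=; rewrite sqr_sqrtr ?addr_ge0 ?sqr_ge0// lerDl sqr_ge0. Qed.

Definition expsum (R : rcfType) (I : finType) (z : I -> R[i]) (m : nat) : R[i] :=
  \sum_x z x ^+ m.

(** On the unit circle the common powers cancel. What remains is the sum at frequency |m - k| or its
    conjugate, which has the same modulus. *)
Lemma gap_expsum (R : rcfType) (I : finType) (z : I -> R[i]) (m k : nat) :
  (forall x, normc (z x) = 1) ->
  normc (\sum_x conjc (z x) ^+ m * z x ^+ k) = normc (expsum z (gap m k)).
Proof.
move=> z1.
have zz x : conjc (z x) * z x = 1 by rewrite mulrC -normc_sqr_conj z1 expr1n.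
rewrite /expsum /gap; have [mk|/ltnW km] := leqP m k.
  rewrite (eqP mk); congr normc; apply: eq_bigr => x _.
  by rewrite -{1}(subnKC mk) exprD mulrA -exprMn zz expr1n mul1r.
rewrite (eqP km) addn0 -[RHS]normc_conj rmorph_sum/=; congr normc; apply: eq_bigr => x _.
by rewrite -{1}(subnK km) exprD -mulrA -exprMn zz expr1n mulr1 rmorphXn.
Qed.

Lemma sum_mul_bilinear (K : comPzRingType) (I J : finType) (a b : J -> K) (v w : I -> J -> K) :
  \sum_y (\sum_m a m * v y m) * (\sum_k b k * w y k) =
  \sum_m \sum_k a m * b k * \sum_y v y m * w y k.
Proof.
under eq_bigr do rewrite big_distrlr/=.
rewrite exchange_big/=; apply: eq_bigr => m _.
rewrite exchange_big/=; apply: eq_bigr => k _.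
by rewrite mulr_sumr; apply: eq_bigr => y _; rewrite mulrACA.
Qed.

(* Expanding the square turns the sum over [y] back into the exponential sum
   at the difference of the two frequencies. *)
Lemma second_moment_expand (R : rcfType) (I : finType) (z : I -> R[i])
    (c : nat -> R[i]) (Q : nat) :
  (forall x, normc (z x) = 1) ->
  \sum_y normc (\sum_(m < Q) c m * expsum z m * conjc (z y) ^+ m) ^+ 2 <=
  \sum_(m < Q) \sum_(k < Q)
    (normc (c m) * normc (expsum z m) * (normc (c k) * normc (expsum z k))) * normc (expsum z (gap m k)).
Proof.
move=> z1; set F := expsum z; set V := \sum_y _.
have V0 : 0 <= V by apply: sumr_ge0 => y _; rewrite exprn_ge0 ?normc_ge0.
have VE : (V%:C)%C = \sum_(m < Q) \sum_(k < Q) (c m * F m) * conjc (c k * F k)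
    * \sum_y (conjc (z y) ^+ m * z y ^+ k).
  rewrite -sum_mul_bilinear /V rmorph_sum/=; apply: eq_bigr => y _.
  rewrite normc_sqr_conj; congr (_ * _); rewrite rmorph_sum/=; apply: eq_bigr => k _.
  by rewrite rmorphM/= [conjc (_ ^+ k)]rmorphXn/= conjcK.
have -> : V = normc (V%:C)%C by rewrite /= expr0n addr0 sqrtr_sqr ger0_norm.
rewrite VE; apply: le_trans (normc_sum_le _ _ _) _; apply: ler_sum => m _.
apply: le_trans (normc_sum_le _ _ _) _; apply: ler_sum => k _.
by rewrite !normcM gap_expsum// normc_conj normcM.
Qed.

(** Termwise 2 f <= lam + f^2 / lam. Keeping [lam] free replaces Cauchy-Schwarz and its square
    roots; the balancing value sqrt N is inserted only at the end. *)
Lemma expsum_weighted_le (R : realFieldType) (f : nat -> R) (Q : nat) (lam : R) : 0 < lam ->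
  \sum_(k < Q) f k / k%:R <=
  (lam * (\sum_(k < Q) k%:R^-1) + (\sum_(k < Q) f k ^+ 2 / k%:R) / lam) / 2.
Proof.
move=> l0; rewrite mulr_sumr [X in _ + X]mulr_suml -big_split/= mulr_suml.
apply: ler_sum => k _; rewrite [X in (_ + X) / _]mulrAC -mulrDl mulrAC.
rewrite ler_wpM2r ?invr_ge0// -subr_ge0.
have -> : (lam + f k ^+ 2 / lam) / 2 - f k = (lam - f k) ^+ 2 / (2 * lam).
  by field; rewrite gt_eqF.
by rewrite divr_ge0 ?sqr_ge0// mulr_ge0// ltW.
Qed.

Lemma second_moment_bound (R : rcfType) (I : finType) (z : I -> R[i])
    (c : nat -> R[i]) (Q : nat) (kap lam : R) :
  (forall x, normc (z x) = 1) ->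
  (forall m, normc (c m) <= kap) -> (forall m, normc (c m) <= 2 / m%:R) -> 0 < lam ->
  \sum_y normc (\sum_(m < Q) c m * expsum z m * conjc (z y) ^+ m) ^+ 2 <=
    2 * kap * #|I|%:R * (\sum_(m < Q) normc (expsum z m) ^+ 2 / m%:R)
  + 4 * (lam * (\sum_(m < Q) m%:R^-1) + (\sum_(m < Q) normc (expsum z m) ^+ 2 / m%:R) / lam)
    * (\sum_(m < Q) normc (expsum z m) ^+ 2 / m%:R).
Proof.
move=> z1 ck c2 l0; set F := expsum z.
set G := \sum_(m < Q) _ / _; set H := \sum_(m < Q) _^-1.
apply: le_trans (@second_moment_expand _ _ z c Q z1) _ => /=.
apply: le_trans (@trilinear_bound _ (fun m => normc (F m)) (fun m => normc (c m))
  Q kap _ _ ck c2) _ => [i|i|]; rewrite ?normc_ge0//.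
have G0 : 0 <= G by apply: sumr_ge0 => i _; rewrite divr_ge0// exprn_ge0 ?normc_ge0.
have -> : normc (F 0%N) = #|I|%:R.
  rewrite /F /expsum; under eq_bigr do rewrite expr0.
  by rewrite sumr_const -(rmorph_nat (real_complex R))/= expr0n addr0 sqrtr_sqr ger0_norm.
rewrite lerD2l -/G ler_wpM2r//.
have := @expsum_weighted_le _ (fun m => normc (F m)) Q lam l0.
rewrite -/G -/H; lra.
Qed.

(** * Fejer kernels *)

Definition e (R : realType) (x : R) : R[i] :=
  Complex (cos (2 * pi * x)) (sin (2 * pi * x)).

Lemma eD (R : realType) (x y : R) : e (x + y) = e x * e y.
Proof.
by rewrite /e mulrDr cosD sinD; apply/eqP; rewrite eq_complex/=; apply/andP; split; apply/eqP; ring.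
Qed.

Lemma e0 (R : realType) : e (0 : R) = 1.
Proof. by rewrite /e mulr0 cos0 sin0. Qed.

Lemma e1 (R : realType) : e (1 : R) = 1.
Proof. by rewrite /e mulr1 mulr_natl cos2pi sin2pi. Qed.

Lemma eN (R : realType) (x : R) : e (- x) = conjc (e x).
Proof. by rewrite /e mulrN cosN sinN. Qed.

Lemma normc_e (R : realType) (x : R) : normc (e x) = 1.
Proof. by rewrite /= cos2Dsin2 sqrtr1. Qed.

Lemma e_mulrn (R : realType) (x : R) n : e (n%:R * x) = e x ^+ n.
Proof.
elim: n => [|n IH]; first by rewrite mul0r e0.
by rewrite -natr1 mulrDl mul1r eD IH exprSr.
Qed.

Lemma e_int (R : realType) (n : int) : e (n%:~R : R) = 1.
Proof.
case: n => n; first by rewrite -[_%:~R]mulr1 e_mulrn e1 expr1n.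
by rewrite NegzE mulrNz eN -[_%:~R]mulr1 e_mulrn e1 expr1n conjc1.
Qed.

(** The mean value theorem on [0, x/2] gives sin (x/2) >= (x/2) cos (x/2), hence sin x >= x cos^2
    (x/2) by the double angle formula. Finally cos^2 (x/2) >= 1/2 because cos x >= 0. *)
Lemma sin_ge_half (R : realType) (x : R) : 0 <= x <= pi / 2 -> x / 2 <= sin x.
Proof.
move=> /andP[x0 xp].
have [->|xneq0] := eqVneq x 0; first by rewrite sin0 mul0r.
have xgt0 : 0 < x by rewrite lt_def xneq0.
have h0 : 0 < x / 2 by rewrite divr_gt0.
have ppi := pi_gt0 R.
have [c cin cE] : exists2 c, c \in `]0, (x / 2)[%R & sin (x / 2) - sin 0 = cos c * (x / 2 - 0).
  apply: MVT => //.
  by apply: continuous_subspaceT => y; exact: continuous_sin.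
move: cin; rewrite in_itv/= => /andP[c0 cx].
have c2 : 2^-1 <= cos (x / 2) ^+ 2.
  have := cosD (x / 2) (x / 2); rewrite -mulr2n -(mulr_natr (x/2)) divfK// => cE2.
  have : 0 <= cos x.
    by apply: cos_ge0_pihalf; apply/andP; split => //; apply: le_trans x0; rewrite oppr_le0 divr_ge0 ?ltW.
  have := cos2Dsin2 (x / 2); rewrite -!expr2 in cE2; lra.
have cpos : 0 <= cos (x / 2).
  by apply: cos_ge0_pihalf; apply/andP; split; [apply: (@le_trans _ _ 0); lra|lra].
have cle : cos (x / 2) <= cos c.
  by apply: ltW; rewrite ltr_cos// in_itv/=; apply/andP; split; lra.
have sE : sin x = 2 * sin (x / 2) * cos (x / 2).
  by have := sinD (x / 2) (x / 2); rewrite -mulr2n -(mulr_natr (x/2)) divfK// => ->; ring.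
move: cE; rewrite sin0 !subr0 => cE.
rewrite sE cE.
have -> : 2 * (cos c * (x / 2)) * cos (x / 2) = x * (cos c * cos (x / 2)) by field.
rewrite ler_wpM2l// (le_trans c2)// expr2 ler_wpM2r//.
Qed.

(** Both sides are invariant under u -> 1 - u, so it suffices to treat u <= 1/2, where pi >= 2 and
    the previous bound give sin (pi u) >= u. *)
Lemma sin_pi_ge (R : realType) (u : R) : 0 <= u <= 1 -> u * (1 - u) <= sin (pi * u).
Proof.
have ppi := pi_gt0 R; have p2 := pi_ge2 R.
have H (v : R) : 0 <= v <= 2^-1 -> v <= sin (pi * v).
  move=> /andP[v0 v2]; apply: le_trans (sin_ge_half _).
    by rewrite -{1}[v]mul1r mulrAC ler_wpM2r//; lra.
  by apply/andP; split; nra.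
move=> /andP[u0 u1]; have [u2|/ltW u2] := leP u 2^-1.
  by apply: le_trans (H u _); rewrite ?u0//; nra.
have -> : sin (pi * u) = sin (pi * (1 - u)).
  by rewrite mulrBr mulr1 sinB sinpi cospi mul0r sub0r mulN1r opprK.
by apply: le_trans (H (1 - u) _); [nra|lra].
Qed.

(** The modulus equals 2 sin (pi u). *)
Lemma normc_1Be (R : realType) (u : R) : 0 <= u <= 1 ->
  2 * (u * (1 - u)) <= normc (1 - e u).
Proof.
move=> u01; have su := sin_pi_ge u01.
have u1 : 0 <= u * (1 - u) by case/andP: u01 => ? ?; rewrite mulr_ge0// subr_ge0.
suff -> : normc (1 - e u) = 2 * sin (pi * u) by rewrite ler_pM2l.
rewrite /e -mulrA mulr_natl mulr2n cosD sinD/=.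
have := cos2Dsin2 (pi * u); set c := cos _; set s := sin _ => cs.
have -> : (1 - (c * c - s * s)) ^+ 2 + (0 - (s * c + c * s)) ^+ 2 = (2 * s) ^+ 2.
  have -> : c * c = 1 - s * s by rewrite -!expr2 -cs addrK.
  have -> : (0 - (s * c + c * s)) ^+ 2 = 4 * s ^+ 2 * (c ^+ 2) by ring.
  have -> : c ^+ 2 = 1 - s ^+ 2 by rewrite -cs addrK.
  by ring.
by rewrite sqrtr_sqr ger0_norm// mulr_ge0// (le_trans u1).
Qed.

Lemma normc_geom_le (R : rcfType) (z : R[i]) n : normc z = 1 ->
  normc (1 - z) * normc (\sum_(j < n) z ^+ j) <= 2.
Proof.
move=> z1; rewrite -normcM -[1 - z]opprB mulNr -subrX1 opprB.
by apply: le_trans (le_normcD _ _) _; rewrite normcN normcX z1 normc1 expr1n.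
Qed.

(** This is the usual Fejer kernel divided by one more factor [Q]. For [Q > 0] its peak value is 1
    and its mean is 1 / Q, so that its [Q] translates by multiples of 1 / Q can sum to 1. *)
Definition fejer (R : realType) (Q : nat) (t : R) : R :=
  normc (\sum_(j < Q) e t ^+ j) ^+ 2 / Q%:R ^+ 2.

Lemma fejer_ge0 (R : realType) Q (t : R) : 0 <= fejer Q t.
Proof. by rewrite divr_ge0 ?exprn_ge0// normc_ge0. Qed.

(** With u the representative of [t] in [d, 1 - d], necessarily d <= 1/2 and |1 - e(u)| >= 2 u (1 -
    u) >= 2 d (1 - d) >= d, so the geometric sum is at most 2 / d. *)
Lemma fejer_tail (R : realType) Q (t d : R) (n : int) : 0 < d -> d <= t - n%:~R <= 1 - d ->
  fejer Q t <= 4 / (Q%:R * d) ^+ 2.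
Proof.
move=> d0 /andP[td t1d]; set u := t - n%:~R in td t1d.
have -> : fejer Q t = fejer Q u by rewrite /fejer /u -mulrNz eD e_int mulr1.
have u01 : 0 <= u <= 1 by apply/andP; split; lra.
have dle : d <= normc (1 - e u) by apply: le_trans (normc_1Be u01); nra.
have := @normc_geom_le _ _ Q (normc_e u); set s := normc (\sum_(j < Q) _) => hs.
have s0 : 0 <= s by exact: normc_ge0.
have hds : d * s <= 2 by apply: le_trans hs; rewrite ler_wpM2r.
have -> : 4 / (Q%:R * d) ^+ 2 = (4 / d ^+ 2) / Q%:R ^+ 2 by rewrite exprMn invfM mulrA mulrAC.
rewrite /fejer -/s ler_wpM2r ?invr_ge0 ?exprn_ge0// ler_pdivlMr ?exprn_gt0// -exprMn mulrC.
have : 0 <= d * s by rewrite mulr_ge0// ltW.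
move: (d * s) hds => y; nra.
Qed.

Lemma ReD (R : rcfType) (a b : R[i]) : complex.Re (a + b) = complex.Re a + complex.Re b.
Proof. by case: a b => [? ?] []. Qed.

(** Each difference m > 0 of two exponents below [Q] occurs Q - m times, and pairs with its
    conjugate. In the induction, the cross terms between z^Q and the earlier powers are z, ..., z^Q,
    once each, which raises every multiplicity by one. *)
Lemma sqr_geom_Re (R : rcfType) (z : R[i]) Q : normc z = 1 ->
  normc (\sum_(j < Q) z ^+ j) ^+ 2 =
  Q%:R + 2 * complex.Re (\sum_(m < Q) ((if m == 0%N :> nat then 0 else Q%:R - m%:R)%:C)%C * z ^+ m).
Proof.
move=> z1; elim: Q => [|Q IH].
  by rewrite !big_ord0 normc0 expr0n/= mulr0 addr0.
have zz : z * conjc z = 1 by rewrite -normc_sqr_conj z1 expr1n.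
have sqD (a b : R[i]) : normc (a + b) ^+ 2 = normc a ^+ 2 + normc b ^+ 2 + 2 * complex.Re (b * conjc a).
  case: a b => [a1 a2] [b1 b2] /=; rewrite !sqr_sqrtr ?addr_ge0 ?sqr_ge0//; ring.
rewrite big_ord_recr/= sqD IH normcX z1 !expr1n.
have -> : z ^+ Q * conjc (\sum_(j < Q) z ^+ j) = \sum_(j < Q) z ^+ j.+1.
  rewrite rmorph_sum/= mulr_sumr (reindex_inj rev_ord_inj)/=; apply: eq_bigr => j _.
  have {1}-> : Q = (j.+1 + (Q - j.+1))%N by rewrite subnKC.
  by rewrite rmorphXn/= exprD -mulrA -exprMn zz expr1n mulr1.
have W : \sum_(m < Q.+1) ((if m == 0%N :> nat then 0 else Q.+1%:R - m%:R)%:C)%C * z ^+ m =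
    \sum_(m < Q) ((if m == 0%N :> nat then 0 else Q%:R - m%:R)%:C)%C * z ^+ m
    + \sum_(j < Q) z ^+ j.+1.
  case: {IH} Q => [|Q]; first by rewrite big_ord1 !big_ord0 mul0r addr0.
  rewrite big_ord_recl/= mul0r add0r [X in _ = X + _]big_ord_recl/= mul0r add0r.
  rewrite [X in _ = _ + X]big_ord_recr big_ord_recr/= addrA -big_split/=.
  congr (_ + _); last by rewrite /bump add1n -natrB// subSnn mul1r.
  apply: eq_bigr => i _; rewrite /bump add1n -{3}[z ^+ i.+1]mul1r -mulrDl.
  by congr (_ * _); rewrite -(rmorph1 (real_complex R)) -rmorphD/= -[Q.+2%:R]natr1 addrAC.
rewrite W.
by rewrite ReD -natr1; ring.
Qed.

Lemma conjc_1B (R : rcfType) (z : R[i]) : 1 - conjc z = conjc (1 - z).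
Proof.
case: z => a b; apply/eqP; rewrite eq_complex/=; apply/andP; split => //.
by rewrite opprB sub0r opprK subr0.
Qed.

Lemma normc_real (R : rcfType) (x : R) : normc (x%:C)%C = `|x|.
Proof. by rewrite /= expr0n addr0 sqrtr_sqr. Qed.

Lemma Re_sum (R : rcfType) (I : Type) (r : seq I) (P : pred I) (F : I -> R[i]) :
  complex.Re (\sum_(i <- r | P i) F i) = \sum_(i <- r | P i) complex.Re (F i).
Proof. by elim/big_rec2 : _ => // i y x _ <-; rewrite ReD. Qed.

Lemma Re_realM (R : rcfType) (x : R) (z : R[i]) : complex.Re ((x%:C)%C * z) = x * complex.Re z.
Proof. by case: z => a b /=; rewrite mul0r subr0. Qed.

(* [psi Q b len] is a smooth trigonometric substitute for the indicator of the
   arc [[b, b + len / Q]]. *)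
Definition psi (R : realType) (Q : nat) (b : R) (len : nat) (t : R) : R :=
  \sum_(i < len) fejer Q (t - (b + i%:R / Q%:R)).

(** Only frequencies m > 0 are kept, with a factor 2, since the kernel is recovered as a constant
    term plus a real part. *)
Definition psi_coef (R : realType) (Q : nat) (b : R) (len : nat) (m : nat) : R[i] :=
  (((if m == 0%N then 0 else 2 * (Q%:R - m%:R) / Q%:R ^+ 2))%:C)%C
  * \sum_(i < len) e (- (b + i%:R / Q%:R)) ^+ m.

Lemma psiE (R : realType) Q (b : R) len t : (0 < Q)%N ->
  psi Q b len t = len%:R / Q%:R + complex.Re (\sum_(m < Q) psi_coef Q b len m * e t ^+ m).
Proof.
move=> Q0; have Qn0 : Q%:R != 0 :> R by rewrite pnatr_eq0 -lt0n.
rewrite /psi.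
under eq_bigr => i _ do rewrite /fejer sqr_geom_Re ?normc_e// mulrDl.
rewrite big_split/= sumr_const card_ord; congr (_ + _).
  by rewrite -mulr_natl; field.
have -> : \sum_(m < Q) psi_coef Q b len m * e t ^+ m =
    \sum_(i < len) \sum_(m < Q) (((if m == 0%N :> nat then 0 else 2 * (Q%:R - m%:R) / Q%:R ^+ 2))%:C)%C
       * e (t - (b + i%:R / Q%:R)) ^+ m.
  rewrite exchange_big/=; apply: eq_bigr => m _.
  rewrite /psi_coef -mulrA mulr_suml mulr_sumr; apply: eq_bigr => i _.
  by rewrite eD exprMn; congr (_ * _); rewrite mulrC.
rewrite Re_sum; apply: eq_bigr => i _.
rewrite !Re_sum mulr_sumr mulr_suml; apply: eq_bigr => m _.
by rewrite !Re_realM; case: ifP => _; rewrite ?(mul0r, mulr0)//; ring.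
Qed.

Lemma psi_coef_geom (R : realType) Q (b : R) len m : 
  \sum_(i < len) e (- (b + i%:R / Q%:R)) ^+ m =
  e (- b) ^+ m * \sum_(i < len) (conjc (e (m%:R / Q%:R))) ^+ i.
Proof.
rewrite mulr_sumr; apply: eq_bigr => i _.
rewrite opprD eD exprMn; congr (_ * _).
by rewrite -eN -!e_mulrn; congr e; ring.
Qed.

Lemma psi_coef_le_len (R : realType) Q (b : R) len m : (m < Q)%N ->
  normc (psi_coef Q b len m) <= 2 * len%:R / Q%:R.
Proof.
move=> mQ; have Q0 : (0 < Q%:R :> R) by rewrite ltr0n (leq_ltn_trans _ mQ).
rewrite /psi_coef normcM normc_real.
have h : normc (\sum_(i < len) e (- (b + i%:R / Q%:R)) ^+ m) <= len%:R.
  apply: le_trans (normc_sum_le _ _ _) _.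
  under eq_bigr do rewrite normcX normc_e expr1n.
  by rewrite sumr_const card_ord.
have mQ' : m%:R < Q%:R :> R by rewrite ltr_nat.
have h2 : `|if m == 0%N then 0 else 2 * (Q%:R - m%:R) / Q%:R ^+ 2| <= 2 / Q%:R :> R.
  case: ifP => _; first by rewrite normr0 divr_ge0// ltW.
  rewrite ger0_norm ?divr_ge0 ?exprn_ge0 ?mulr_ge0 ?subr_ge0 ?(ltW mQ') ?(ltW Q0)//.
  rewrite ler_pdivrMr ?exprn_gt0//.
  have -> : 2 / Q%:R * Q%:R ^+ 2 = 2 * Q%:R :> R by field; rewrite gt_eqF.
  by rewrite ler_wpM2l// gerBl.
by apply: le_trans (ler_pM _ _ h2 h) _; rewrite ?normc_ge0// mulrAC.
Qed.

(** With u = m / Q, the Fejer weight 2 (Q - m) / Q^2 equals (2 / m) u (1 - u), and u (1 - u) is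
    exactly what compensates the bound 1 / (u (1 - u)) for the geometric sum over the translates.
    The result does not depend on [len]. *)
Lemma psi_coef_le_inv (R : realType) Q (b : R) len m : (m < Q)%N ->
  normc (psi_coef Q b len m) <= 2 / m%:R.
Proof.
move=> mQ; have Q0 : (0 < Q%:R :> R) by rewrite ltr0n (leq_ltn_trans _ mQ).
rewrite /psi_coef normcM normc_real.
have [->|m0] := posnP m; first by rewrite /= normr0 mul0r divr_ge0.
rewrite psi_coef_geom normcM normcX normc_e expr1n mul1r.
set u := m%:R / Q%:R : R; set S := normc _.
have mR0 : 0 < m%:R :> R by rewrite ltr0n.
have u0 : 0 < u by rewrite divr_gt0.
have u1 : u < 1 by rewrite ltr_pdivrMr// mul1r ltr_nat.
have hS : (u * (1 - u)) * S <= 1.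
  have := @normc_geom_le _ (conjc (e u)) len; rewrite normc_conj normc_e => /(_ erefl).
  rewrite -/S conjc_1B normc_conj => h.
  have := @normc_1Be _ u; rewrite (ltW u0) (ltW u1) => /(_ isT) h2.
  have S0 : 0 <= S by exact: normc_ge0.
  have := ler_wpM2r S0 h2; lra.
have -> : 2 * (Q%:R - m%:R) / Q%:R ^+ 2 = 2 / m%:R * (u * (1 - u)).
  by rewrite /u; field; rewrite !gt_eqF.
rewrite normrM !ger0_norm ?divr_ge0 ?mulr_ge0 ?subr_ge0 ?(ltW u0) ?(ltW u1)//.
by rewrite -mulrA ler_piMr// divr_ge0.
Qed.

(** At each frequency 0 < m < Q the coefficient contains a full sum of powers of a Q-th root of
    unity different from 1, which vanishes. This partition of unity turns a lower bound on an arc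
    into an upper bound on its complement. *)
Lemma psi_total (R : realType) Q (b t : R) : (0 < Q)%N -> psi Q b Q t = 1.
Proof.
move=> Q0; have QR0 : Q%:R != 0 :> R by rewrite pnatr_eq0 -lt0n.
rewrite psiE// divff// big1 ?addr0// => m _.
rewrite /psi_coef; case: ifP => m0; first by rewrite !mul0r.
rewrite psi_coef_geom; set w := conjc _.
suff -> : \sum_(i < Q) w ^+ i = 0 by rewrite !(mulr0, mul0r).
have mR0 : 0 < m%:R :> R by rewrite ltr0n lt0n m0.
have Qp : 0 < Q%:R :> R by rewrite ltr0n.
have u0 : 0 < m%:R / Q%:R :> R by rewrite divr_gt0.
have u1 : m%:R / Q%:R < 1 :> R by rewrite ltr_pdivrMr// mul1r ltr_nat.
have wn1 : w - 1 != 0.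
  apply/eqP => w1; have := @normc_1Be _ (m%:R / Q%:R : R).
  rewrite (ltW u0) (ltW u1) => /(_ isT).
  have -> : 1 - e (m%:R / Q%:R) = conjc (- (w - 1)) :> R[i].
    by rewrite opprB -conjc_1B conjcK.
  rewrite w1 oppr0 conjc0 normc0 leNgt mulr_gt0// mulr_gt0// subr_gt0//.
apply: (mulfI wn1); rewrite mulr0 -subrX1 /w -rmorphXn/= -e_mulrn.
have -> : Q%:R * (m%:R / Q%:R) = m%:R * 1 :> R by field.
by rewrite e_mulrn e1 expr1n conjc1 subrr.
Qed.

Lemma psi_split (R : realType) Q (b t : R) l k :
  psi Q b (l + k) t = psi Q b l t + psi Q (b + l%:R / Q%:R) k t.
Proof.
rewrite /psi big_split_ord/=; congr (_ + _); apply: eq_bigr => i _.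
by congr fejer; rewrite natrD mulrDl !addrA.
Qed.

Lemma psi_ge0 (R : realType) Q (b t : R) l : 0 <= psi Q b l t.
Proof. by apply: sumr_ge0 => i _; exact: fejer_ge0. Qed.

Lemma psi_le1 (R : realType) Q (b t : R) l : (0 < Q)%N -> (l <= Q)%N -> psi Q b l t <= 1.
Proof.
by move=> Q0 lQ; rewrite -(psi_total b t Q0) -{3}(subnKC lQ) psi_split lerDl psi_ge0.
Qed.

Lemma psi_far (R : realType) Q (b t d : R) l : 0 < d -> (l <= Q)%N ->
  (forall i, (i < l)%N -> exists n : int, d <= t - (b + i%:R / Q%:R) - n%:~R <= 1 - d) ->
  psi Q b l t <= 4 / (Q%:R * d ^+ 2).
Proof.
move=> d0 lQ far; case: (posnP Q) => [Q0|Q0].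
  by move: lQ; rewrite Q0 leqn0 => /eqP->; rewrite /psi big_ord0 mul0r invr0 mulr0.
have QR0 : 0 < Q%:R :> R by rewrite ltr0n.
apply: (le_trans (y := \sum_(i < l) 4 / (Q%:R * d) ^+ 2)).
  by apply: ler_sum => i _; have [n hn] := far i (ltn_ord i); apply: fejer_tail hn.
rewrite sumr_const card_ord -[leLHS]mulr_natl.
apply: (le_trans (y := Q%:R * (4 / (Q%:R * d) ^+ 2))).
  by apply: ler_wpM2r; rewrite ?ler_nat// divr_ge0// exprn_ge0// mulr_ge0// ltW.
rewrite le_eqVlt; apply/orP; left; apply/eqP; field.
by rewrite !gt_eqF.
Qed.

(** * Variance of the number of points in a window *)

(* The term [m = 0] vanishes, since [x / 0 = 0]. *)
Definition expsum_energy (R : rcfType) (I : finType) (z : I -> R[i]) (Q : nat) : R :=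
  \sum_(m < Q) normc (expsum z m) ^+ 2 / m%:R.

(** The constant term of the kernel accounts for the expected count. The deviation is the real part
    of the trigonometric sum already bounded in mean square. *)
Lemma psi_second_moment (R : realType) (I : finType) (p : I -> R) (Q : nat) (b lam : R) len :
  (0 < Q)%N -> 0 < lam ->
  \sum_y (\sum_x psi Q b len (p x - p y) - #|I|%:R * (len%:R / Q%:R)) ^+ 2 <=
  4 * (#|I|%:R * (len%:R / Q%:R)) * expsum_energy (fun x => e (p x)) Q
  + 4 * (lam * (\sum_(m < Q) m%:R^-1) + expsum_energy (fun x => e (p x)) Q / lam)
    * expsum_energy (fun x => e (p x)) Q.
Proof.
move=> Q0 lam0; set G := expsum_energy _ _.
pose z (x : I) := e (p x).
(* The coefficient bounds are available only below [Q], whereas the general estimate asks for them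
   at every frequency; hence the extension by zero. *)
pose c (m : nat) := if (m < Q)%N then psi_coef Q b len m else 0.
have ck m : normc (c m) <= 2 * len%:R / Q%:R.
  by rewrite /c; case: ifP => [/psi_coef_le_len//|_]; rewrite normc0 divr_ge0// mulr_ge0.
have c2 m : normc (c m) <= 2 / m%:R.
  by rewrite /c; case: ifP => [/psi_coef_le_inv//|_]; rewrite normc0 divr_ge0.
have := @second_moment_bound _ _ z c Q _ _ (fun x => normc_e (p x)) ck c2 lam0.
rewrite -/(expsum_energy z Q) -/G => hb.
have -> : 4 * (#|I|%:R * (len%:R / Q%:R)) * G = 2 * (2 * len%:R / Q%:R) * #|I|%:R * G by ring.
apply: le_trans hb; apply: ler_sum => y _.
suff -> : \sum_x psi Q b len (p x - p y) - #|I|%:R * (len%:R / Q%:R) =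
    complex.Re (\sum_(m < Q) c m * expsum z m * conjc (z y) ^+ m) by exact: sqr_Re_le.
under eq_bigr => x _ do rewrite psiE//.
rewrite big_split/= sumr_const -[_ *+ #|_|]mulr_natl addrAC subrr add0r -Re_sum exchange_big/=.
congr complex.Re; apply: eq_bigr => m _; rewrite /c ltn_ord -mulrA -mulr_sumr.
congr (_ * _); rewrite /expsum.
rewrite mulr_suml; apply: eq_bigr => x _.
by rewrite eD eN exprMn.
Qed.

(** The arc is widened by [d] on both sides and its length rounded up. A point of the window is then
    far from every centre of the complementary arc, whose kernels therefore contribute little to the
    total 1. *)
Lemma psi_majorant (R : realType) (Q : nat) (u v d s : R) (n : int) :
  0 < d -> d <= 2^-1 -> (0 < Q)%N -> Q%:R * (v - u + 2 * d) + 1 <= Q%:R -> u <= s - n%:~R <= v ->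
  1 - 4 / (Q%:R * d ^+ 2) <= psi Q (u - d) (Num.truncn (Q%:R * (v - u + 2 * d))).+1 s.
Proof.
move=> d0 d2 Q0 lenQ /andP[us sv].
have QR : 0 < Q%:R :> R by rewrite ltr0n.
set len := (Num.truncn _).+1.
have uv : 0 <= v - u by rewrite subr_ge0 (le_trans us).
have lenQ' : (len <= Q)%N.
  have : (Num.truncn (Q%:R * (v - u + 2 * d)))%:R <= Q%:R * (v - u + 2 * d).
    by rewrite truncn_le mulr_ge0//; lra.
  rewrite -(ler_nat R) /len -natr1 => h; lra.
have lenlb : v + d <= u - d + len%:R / Q%:R.
  have : Q%:R * (v - u + 2 * d) <= len%:R by apply/ltW/truncnS_gt.
  rewrite mulrC -ler_pdivlMr// => h; lra.
rewrite lerBlDl -lerBlDr; have tot : psi Q (u - d) (len + (Q - len)) s = 1 by rewrite subnKC// psi_total.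
rewrite psi_split in tot.
have -> : 1 - psi Q (u - d) len s = psi Q (u - d + len%:R / Q%:R) (Q - len) s by lra.
apply: psi_far => //; first exact: leq_subr.
(* The complementary centres lie between v + d and u - d + 1, thus beyond s - n; one more turn
   brings the difference into [d, 1 - d]. *)
move=> i iQ; exists (n - 1).
have iQR : len%:R / Q%:R + i%:R / Q%:R < 1 :> R.
  by rewrite -mulrDl ltr_pdivrMr// mul1r -natrD ltr_nat -ltn_subRL.
have i0 : 0 <= i%:R / Q%:R :> R by rewrite divr_ge0// ltW.
rewrite intrB; apply/andP; split; lra.
Qed.

(** The arc is narrowed by [d] on both sides and its length rounded down, so a point outside the
    window is far from every centre. *)
Lemma psi_minorant (R : realType) (Q : nat) (u v d s : R) :
  0 < d -> d <= 2^-1 -> (0 < Q)%N -> (Num.truncn (Q%:R * (v - u - 2 * d)) <= Q)%N ->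
  ~ (exists n : int, u < s - n%:~R < v) ->
  psi Q (u + d) (Num.truncn (Q%:R * (v - u - 2 * d))) s <= 4 / (Q%:R * d ^+ 2).
Proof.
move=> d0 d2 Q0 lenQ nos; have QR : 0 < Q%:R :> R by rewrite ltr0n.
apply: psi_far => // i; rewrite truncn_gt_nat => iQ.
have iv : u + d + i%:R / Q%:R <= v - d.
  have : i%:R <= Q%:R * (v - u - 2 * d) by apply: le_trans iQ; rewrite ler_nat.
  rewrite mulrC -ler_pdivrMr// => h; lra.
have i0 : 0 <= i%:R / Q%:R :> R by rewrite divr_ge0// ltW.
set c := u + d + _ in iv *.
exists (Num.floor (s - c)).
have := floor_itv (s - c); set n := Num.floor _; rewrite intrD => /andP[n1 n2].
apply/andP; split; rewrite leNgt; apply/negP => h; apply: nos.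
  by exists n; rewrite /c in n1 n2 h iv *; apply/andP; split; lra.
by exists (n + 1); rewrite intrD /c in n1 n2 h iv *; apply/andP; split; lra.
Qed.

Lemma natr_card (R : realType) (I : finType) (P : pred I) : #|P|%:R = \sum_x (P x)%:R :> R.
Proof.
rewrite -sum1_card natr_sum big_mkcond/=; apply: eq_bigr => x _.
by rewrite unfold_in; case: (P x).
Qed.

(** [P] is only required to lie between the open and the closed window modulo 1. Windows half-open
    on either side are thus covered, which matters because negating the difference swaps the
    ends. *)
Lemma count_variance (R : realType) (I : finType) (p : I -> R) (P : I -> pred I)
    (u v lam : R) :
  let N := #|I| in let Q := (N ^ 4)%N in
  (10 <= N)%N -> 0 < lam -> u <= v -> v - u <= 2^-1 ->
  (forall y x, P y x -> exists n : int, u <= p x - p y - n%:~R <= v) ->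
  (forall y x, (exists n : int, u < p x - p y - n%:~R < v) -> P y x) ->
  (\sum_y (#|P y|%:R - N%:R * (v - u)) ^+ 2 <=
  16 * (N%:R * (v - u) + 3) * expsum_energy (fun x => e (p x)) Q
  + 16 * (lam * (\sum_(m < Q) m%:R^-1) + expsum_energy (fun x => e (p x)) Q / lam)
    * expsum_energy (fun x => e (p x)) Q + 98 * N%:R)%R.
Proof.
move=> N Q N10 lam0 uv uv2 PU PL.
set G := expsum_energy _ _; set H := \sum_(m < Q) _.
have N0 : 0 < N%:R :> R by rewrite ltr0n (leq_trans _ N10).
have N10R : 10 <= N%:R :> R by rewrite ler_nat.
have Q0 : (0 < Q)%N by rewrite expn_gt0 (leq_trans _ N10).
have QE : Q%:R = N%:R ^+ 4 :> R by rewrite natrX.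
have QR : 0 < Q%:R :> R by rewrite ltr0n.
have G0 : 0 <= G by apply: sumr_ge0 => m _; rewrite divr_ge0// exprn_ge0// normc_ge0.
(* Smoothing at scale 1 / N displaces the expected count by 2, and the total leakage is N tau = 4 /
   N. *)
pose d : R := N%:R^-1.
have d0 : 0 < d by rewrite invr_gt0.
have dN : N%:R * d = 1 by rewrite mulfV// gt_eqF.
have d10 : d <= 10^-1 by rewrite lef_pV2 ?posrE.
have d2 : d <= 2^-1 by apply: le_trans d10 _; rewrite lef_pV2 ?posrE// ler_nat.
pose tau : R := 4 / (Q%:R * d ^+ 2).
have tauN : N%:R * tau <= 4.
  have -> : N%:R * tau = 4 / N%:R by rewrite /tau QE /d; field; rewrite gt_eqF.
  by rewrite ler_pdivrMr// ler_peMr//; lra.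
set W := N%:R * (v - u).
pose l1 := (Num.truncn (Q%:R * (v - u + 2 * d))).+1.
pose l2 := Num.truncn (Q%:R * (v - u - 2 * d)).
have QN : N%:R / Q%:R <= 1 :> R.
  by rewrite ler_pdivrMr// mul1r ler_nat /Q -{1}(expn1 N) leq_exp2l// (leq_trans _ N10).
have Q10 : 10 <= Q%:R :> R.
  by apply: le_trans N10R _; move: QN; rewrite ler_pdivrMr// mul1r.
have l1Q : Q%:R * (v - u + 2 * d) + 1 <= Q%:R by nra.
(* The 3 is 2 from the widening by 2 d, plus at most N / Q <= 1 from rounding the length. *)
have l1E : N%:R * (l1%:R / Q%:R) <= W + 3.
  have h : (Num.truncn (Q%:R * (v - u + 2 * d)))%:R <= Q%:R * (v - u + 2 * d).
    rewrite truncn_le; apply: mulr_ge0; first exact: ltW.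
    lra.
  have h2 : l1%:R / Q%:R <= (v - u + 2 * d) + Q%:R^-1.
    rewrite ler_pdivrMr// [leRHS]mulrDl mulVf ?gt_eqF// -[l1%:R]natr1 lerD2r [leRHS]mulrC; lra.
  have := ler_wpM2l (ltW N0) h2; rewrite /W => h3; nra.
have l2E : W - 3 <= N%:R * (l2%:R / Q%:R) /\ N%:R * (l2%:R / Q%:R) <= W.
  have h : Q%:R * (v - u - 2 * d) < l2.+1%:R by exact: truncnS_gt.
  split.
    have h2 : v - u - 2 * d <= l2%:R / Q%:R + Q%:R^-1.
      have -> : l2%:R / Q%:R + Q%:R^-1 = l2.+1%:R / Q%:R :> R by rewrite -[l2.+1%:R]natr1 mulrDl mul1r.
      by rewrite ler_pdivlMr// mulrC ltW.
    have := ler_wpM2l (ltW N0) h2; rewrite /W => h3; nra.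
  rewrite /W ler_wpM2l ?(ltW N0)// ler_pdivrMr// mulrC.
  have [neg|pos] := leP 0 (Q%:R * (v - u - 2 * d)).
    apply: (le_trans (y := Q%:R * (v - u - 2 * d))); first by rewrite truncn_le.
    by rewrite ler_wpM2l ?(ltW QR)//; lra.
  have -> : l2 = 0%N by apply/eqP; rewrite -leqn0 truncn_le_nat; lra.
  by rewrite mulr_ge0 ?(ltW QR)// subr_ge0.
have l2Q : (l2 <= Q)%N.
  by rewrite truncn_le_nat -[Q.+1%:R]natr1; nra.
pose E1 y := \sum_x psi Q (u - d) l1 (p x - p y) - N%:R * (l1%:R / Q%:R).
pose E2 y := \sum_x psi Q (u + d) l2 (p x - p y) - N%:R * (l2%:R / Q%:R).
have cntE y : #|P y|%:R = \sum_x (P y x)%:R :> R by exact: natr_card.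
have up y : #|P y|%:R - W <= E1 y + 7.
  have : #|P y|%:R <= \sum_x psi Q (u - d) l1 (p x - p y) + N%:R * tau.
    rewrite cntE mulr_natl -sumr_const -big_split/=; apply: ler_sum => x _.
    case: (boolP (P y x)) => [/PU[n hn]|_].
      by have := psi_majorant d0 d2 Q0 l1Q hn; rewrite -/l1 -/tau /=; lra.
    by rewrite addr_ge0 ?psi_ge0// divr_ge0// mulr_ge0 ?(ltW QR)// exprn_ge0// ltW.
  rewrite /E1; lra.
have lo y : E2 y - 7 <= #|P y|%:R - W.
  have : \sum_x psi Q (u + d) l2 (p x - p y) <= #|P y|%:R + N%:R * tau.
    rewrite cntE [X in _ <= _ + X]mulr_natl -sumr_const -big_split/=; apply: ler_sum => x _.
    have tau0 : 0 <= tau by rewrite divr_ge0// mulr_ge0 ?(ltW QR)// exprn_ge0// ltW.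
    case: (boolP (P y x)) => [_|nP].
      by rewrite (le_trans (psi_le1 _ _ Q0 l2Q))// lerDl.
    rewrite add0r; apply: psi_minorant => //.
    by move=> /PL; exact/negP.
  rewrite /E2; case: l2E => ? ?; lra.
(* The 7 is 3 for the change of arc plus 4 for the leakage, and (t + 7)^2 <= 2 t^2 + 98. The sign of
   the deviation decides which of [E1] and [E2] controls it. *)
have sq y : (#|P y|%:R - W) ^+ 2 <= 2 * (E1 y ^+ 2 + E2 y ^+ 2) + 98.
  have := up y; have := lo y; set t := _ - W; set a := E1 y; set b := E2 y => h1 h2.
  have [t0|t0] := leP 0 t.
    have : t ^+ 2 <= (a + 7) ^+ 2 by rewrite !expr2; nra.
    have := sqr_ge0 (a - 7); have := sqr_ge0 b; nra.
  have : t ^+ 2 <= (b - 7) ^+ 2 by rewrite !expr2; nra.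
  have := sqr_ge0 (b + 7); have := sqr_ge0 a; nra.
apply: (le_trans (y := \sum_y (2 * (E1 y ^+ 2 + E2 y ^+ 2) + 98))).
  by apply: ler_sum => y _; exact: sq.
rewrite big_split/= -mulr_sumr big_split/= sumr_const -[X in _ + X]mulr_natl -/N [N%:R * 98]mulrC lerD2r.
have := @psi_second_moment R I p Q (u - d) lam l1 Q0 lam0.
have := @psi_second_moment R I p Q (u + d) lam l2 Q0 lam0.
rewrite -/N -/G -/H => s2 s1.
have g1 : N%:R * (l1%:R / Q%:R) * G <= (W + 3) * G by rewrite ler_wpM2r.
have g2 : N%:R * (l2%:R / Q%:R) * G <= (W + 3) * G by rewrite ler_wpM2r//; case: l2E; lra.
move: s1 s2; rewrite -/(\sum_y E1 y ^+ 2) -/(\sum_y E2 y ^+ 2).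
set S1 := \sum_y _; set S2 := \sum_y _; set K := (lam * H + G / lam) * G.
rewrite -!(mulrA 4) -!(mulrA 16) -/K; lra.
Qed.

(** * The metric estimate *)

Fixpoint dyadic_energy (R : realFieldType) (f : nat -> R) (J o : nat) : R :=
  if J is K.+1 then
    (\sum_(o <= x < o + 2 ^ J) f x) ^+ 2
    + (dyadic_energy f K o + dyadic_energy f K (o + 2 ^ K))
  else f o ^+ 2.

Lemma dyadic_energy_ge0 (R : realFieldType) (f : nat -> R) J o : 0 <= dyadic_energy f J o.
Proof.
elim: J o => [|J IH] o; first exact: sqr_ge0.
by rewrite addr_ge0 ?sqr_ge0// addr_ge0.
Qed.

Lemma dyadic_energy_top (R : realFieldType) (f : nat -> R) J o :
  (\sum_(o <= x < o + 2 ^ J) f x) ^+ 2 <= dyadic_energy f J o.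
Proof.
case: J => [|J]; first by rewrite expn0 addn1 big_nat1.
by rewrite lerDl addr_ge0// dyadic_energy_ge0.
Qed.

(* Rademacher-Menshov: an initial segment of a dyadic block is a union of at
   most one dyadic block of each length. *)
Lemma dyadic_maximal (R : realFieldType) (f : nat -> R) J o n : (n <= 2 ^ J)%N ->
  (\sum_(o <= x < o + n) f x) ^+ 2 <= J.+1%:R * dyadic_energy f J o.
Proof.
elim: J o n => [|J IH] o n nJ.
  rewrite mul1r; case: n nJ => [|[|n]]//= _.
    by rewrite addn0 big_geq// expr0n sqr_ge0.
  by rewrite addn1 big_nat1.
have [nle|ngt] := leqP n (2 ^ J).
  apply: le_trans (IH o n nle) _; apply: ler_pM; rewrite ?dyadic_energy_ge0 ?ler_nat//.
  by rewrite /= addrCA lerDl addr_ge0 ?sqr_ge0// dyadic_energy_ge0.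
have nsub : (n - 2 ^ J <= 2 ^ J)%N.
  by rewrite leq_subLR addnn -mul2n -expnS.
have -> : \sum_(o <= x < o + n) f x = \sum_(o <= x < o + 2 ^ J) f x
    + \sum_(o + 2 ^ J <= x < o + 2 ^ J + (n - 2 ^ J)) f x.
  rewrite -big_cat_nat/= ?leq_addr//.
  by rewrite -addnA subnKC// ltnW.
have h1 := @dyadic_energy_top _ f J o; have h2 := IH (o + 2 ^ J)%N _ nsub.
apply: (le_trans (y := J.+2%:R * (dyadic_energy f J o + dyadic_energy f J (o + 2 ^ J)))); last first.
  by rewrite ler_wpM2l//= lerDr sqr_ge0.
move: h1 h2; set a := \sum_(_ <= _ < _) _; set b := \sum_(_ <= _ < _) _.
set A := dyadic_energy _ _ _; set B := dyadic_energy _ _ _ => h1 h2.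
rewrite -[J.+2%:R]natr1; set k : R := J.+1%:R in h2 *.
have k0 : 0 < k by rewrite ltr0n.
(* Weighted Cauchy-Schwarz, (a + b)^2 <= (k + 1) (a^2 + b^2 / k): the weights fit the induction, as
   [a] is one complete block and [b^2] already carries the factor [k]. *)
have h3 : b ^+ 2 + b ^+ 2 / k <= (k + 1) * B.
  have -> : b ^+ 2 + b ^+ 2 / k = (k + 1) / k * b ^+ 2 by field; rewrite gt_eqF.
  rewrite -mulrA ler_wpM2l//; first by rewrite addr_ge0// ltW.
  by rewrite mulrC ler_pdivrMr// mulrC.
have h4 : 0 <= (k * a - b) ^+ 2 / k by rewrite divr_ge0 ?sqr_ge0// ltW.
have h5 : (k * a - b) ^+ 2 / k = k * a ^+ 2 - 2 * a * b + b ^+ 2 / k by field; rewrite gt_eqF.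
have h6 : (k + 1) * a ^+ 2 <= (k + 1) * A by rewrite ler_wpM2l// addr_ge0// ltW.
rewrite h5 in h4; have -> : (a + b) ^+ 2 = a ^+ 2 + 2 * a * b + b ^+ 2 by ring.
rewrite [leRHS]mulrDr; move: (b ^+ 2 / k) h3 h4 => q h3 h4; lra.
Qed.

(** Continuity is bundled with the value, so integrability on [0, 1] is at hand at each use of
    linearity. *)
Definition mean01 (R : realType) (f : R -> R) (v : R) : Prop :=
  continuous f /\ \int[@lebesgue_measure R]_(x in `[0, 1]) f x = v.

Lemma continuous_integrable01 (R : realType) (f : R -> R) : continuous f ->
  (@lebesgue_measure R).-integrable `[0, 1] (EFin \o f).
Proof.
move=> cf; apply: continuous_compact_integrable; first exact: segment_compact.
exact: continuous_subspaceT.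
Qed.

Lemma mean01D (R : realType) (f g : R -> R) v w :
  mean01 f v -> mean01 g w -> mean01 (fun x => f x + g x) (v + w).
Proof.
move=> [cf <-] [cg <-]; split.
  by move=> x; apply: continuousD; [exact: cf | exact: cg].
by rewrite RintegralD//; exact: continuous_integrable01.
Qed.

Lemma mean01Z (R : realType) (f : R -> R) v c :
  mean01 f v -> mean01 (fun x => c * f x) (c * v).
Proof.
move=> [cf <-]; split.
  by move=> x; apply: continuousM; [exact: cst_continuous | exact: cf].
by rewrite RintegralZl//; exact: continuous_integrable01.
Qed.

Lemma mean01_0 (R : realType) : mean01 (fun _ : R => 0) 0.
Proof. by split; [exact: cst_continuous | rewrite Rintegral_cst// mul0r]. Qed.

Lemma mean01_ext (R : realType) (f g : R -> R) v : f =1 g -> mean01 f v -> mean01 g v.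
Proof. by move=> /funext ->. Qed.

Lemma mean01_sum (R : realType) (I : Type) (r : seq I) (P : pred I) (f : I -> R -> R) (v : I -> R) :
  (forall i, P i -> mean01 (f i) (v i)) ->
  mean01 (fun x => \sum_(i <- r | P i) f i x) (\sum_(i <- r | P i) v i).
Proof.
move=> h; elim: r => [|i r IH].
  by rewrite big_nil; apply: mean01_ext (@mean01_0 R) => x; rewrite big_nil.
rewrite big_cons; case: ifP => Pi.
  by apply: mean01_ext (mean01D (h i Pi) IH) => x; rewrite big_cons Pi.
by apply: mean01_ext IH => x; rewrite big_cons Pi.
Qed.

Lemma mean01_cos (R : realType) (k : int) :
  mean01 (fun x : R => cos (2 * pi * (k%:~R * x))) (k == 0)%:R.
Proof.
have ccos (c : R) : continuous (fun x : R => cos (c * x)).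
  move=> x; apply: (@continuous_comp _ _ _ (fun y => c * y) cos).
    by apply: continuousM => //; exact: cst_continuous.
  exact: continuous_cos.
have -> : (fun x : R => cos (2 * pi * (k%:~R * x))) = (fun x : R => cos (2 * pi * k%:~R * x)).
  by apply/funext => x; rewrite !mulrA.
split; first exact: ccos.
have [->|k0] := eqVneq k 0.
  under eq_Rintegral do rewrite mulr0 mul0r cos0.
  rewrite Rintegral_cst// mul1r.
  have /= -> := @lebesgue_measure_itv R `[0, 1]%R.
  by rewrite lte_fin ltr01/= oppr0 addr0.
set c := 2 * pi * k%:~R.
have c0 : c != 0 by rewrite !mulf_neq0 ?intr_eq0// gt_eqF// pi_gt0.
have dF (x : R) : is_derive x (1 : R) (fun x : R => c^-1 * sin (c * x)) (cos (c * x)).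
  apply: is_derive_eq; rewrite /GRing.scale/=.
  by field.

rewrite /Rintegral (@continuous_FTC2 _ _ (fun x => c^-1 * sin (c * x)) 0 1)//.
- rewrite -EFinB/= mulr0 sin0 mulr0 mulr1 subr0 /c.
  by have [_ ->] := @e_int R k; rewrite mulr0.
- exact/continuous_subspaceT/ccos.
- have cF : continuous (fun x : R => c^-1 * sin (c * x)).
    by move=> x; apply/differentiable_continuous/derivable1_diffP; case: (dF x).
  split => [x _| |]; first by case: (dF x).
    exact/cvg_at_right_filter/cF.
  exact/cvg_at_left_filter/cF.
- by move=> x _; rewrite derive1E; case: (dF x).
Qed.

Lemma mean01_expsum_sqr (R : realType) (r : seq nat) (k : nat -> int) :
  uniq r -> {in r &, injective k} ->
  mean01 (fun a : R => (\sum_(x <- r) cos (2 * pi * ((k x)%:~R * a))) ^+ 2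
                     + (\sum_(x <- r) sin (2 * pi * ((k x)%:~R * a))) ^+ 2) (size r)%:R.
Proof.
move=> ur kinj.
have -> : (size r)%:R = \sum_(x <- r) \sum_(y <- r) (k x - k y == 0)%:R :> R.
  rewrite -sum1_size natr_sum; apply: eq_big_seq => x xr.
  rewrite (bigD1_seq x)//= subrr eqxx big_seq_cond big1 ?addr0// => y /andP[yr yx].
  by rewrite subr_eq0; case: eqP => // /kinj xy; rewrite xy ?eqxx in yx.
apply: (@mean01_ext _ (fun a => \sum_(x <- r) \sum_(y <- r) cos (2 * pi * ((k x - k y)%:~R * a)))).
  move=> a; rewrite !expr2 !big_distrlr/= -big_split/=; apply: eq_bigr => x _.
  rewrite -big_split/=; apply: eq_bigr => y _.
  by rewrite intrB mulrBl mulrBr cosB.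
by apply: mean01_sum => x _; apply: mean01_sum => y _; exact: mean01_cos.
Qed.

(** Together with [sinw], the real and imaginary parts of e(m a x^2), kept apart because the maximal
    inequality is stated for real sums. The frequency passes through the integers to match
    [mean01_cos]. *)
Definition cosw (R : realType) (a : R) (m x : nat) : R :=
  cos (2 * pi * ((m * x ^ 2)%N%:Z%:~R * a)).

Definition sinw (R : realType) (a : R) (m x : nat) : R :=
  sin (2 * pi * ((m * x ^ 2)%N%:Z%:~R * a)).

(* Up to a factor [J + 1], this dominates the weighted energy of the first [N]
   squares for all [N <= 2 ^ J] at once. *)
Definition total_energy (R : realType) (J : nat) (a : R) : R :=
  \sum_(m < 2 ^ (4 * J))
    m%:R^-1 * (dyadic_energy (cosw a m) J 1 + dyadic_energy (sinw a m) J 1).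

(** Each block has mean equal to its length by orthogonality, and on each of the [J + 1] levels the
    blocks partition 2^J integers. Positivity of [m] makes the frequencies m x^2 distinct. *)
Lemma mean01_dyadic_energy (R : realType) (m J o : nat) : (0 < m)%N ->
  mean01 (fun a : R => dyadic_energy (cosw a m) J o + dyadic_energy (sinw a m) J o)
    (J.+1%:R * 2 ^+ J).
Proof.
move=> m0.
have block (r : seq nat) : uniq r ->
    mean01 (fun a : R => (\sum_(x <- r) cosw a m x) ^+ 2 + (\sum_(x <- r) sinw a m x) ^+ 2) (size r)%:R.
  move=> ur; apply: mean01_expsum_sqr => // x y _ _ /eqP.
  by rewrite eqz_nat eqn_pmul2l// eqn_exp2r// => /eqP.
elim: J o => [|J IH] o.
  have := block [:: o] isT; rewrite /= mulr1; apply: mean01_ext => a.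
  by rewrite !big_seq1.
have := mean01D (block (index_iota o (o + 2 ^ J.+1)) (iota_uniq _ _)) 
  (mean01D (IH o) (IH (o + 2 ^ J)%N)).
rewrite size_iota addKn => h.
have -> : J.+2%:R * 2 ^+ J.+1 = (2 ^ J.+1)%:R + (J.+1%:R * 2 ^+ J + J.+1%:R * 2 ^+ J) :> R.
  by rewrite -[J.+2%:R]natr1 natrX exprS; ring.
by apply: mean01_ext h => a /=; ring.
Qed.

Lemma harmonic_le (R : realFieldType) K : \sum_(m < 2 ^ K) m%:R^-1 <= K%:R :> R.
Proof.
rewrite -(big_mkord xpredT (fun m => m%:R^-1)).
elim: K => [|K IH]; first by rewrite expn0 big_nat1 invr0.
have le2 : (2 ^ K <= 2 ^ K.+1)%N by rewrite leq_exp2l.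
rewrite (big_cat_nat (leq0n _) le2)/= -natr1 lerD//.
apply: (le_trans (y := \sum_(2 ^ K <= i < 2 ^ K.+1) (2 ^ K)%:R^-1)).
  apply: ler_sum_nat => i /andP[Ki _]; rewrite lef_pV2 ?posrE ?ltr0n ?ler_nat//.
    by rewrite (leq_trans _ Ki)// expn_gt0.
  by rewrite expn_gt0.
rewrite sumr_const_nat expnS mul2n -addnn addnK -[leLHS]mulr_natl mulfV//.
Qed.

Lemma total_energy_ge0 (R : realType) J (a : R) : 0 <= total_energy J a.
Proof.
by apply: sumr_ge0 => m _; rewrite mulr_ge0 ?invr_ge0// addr_ge0// dyadic_energy_ge0.
Qed.

Lemma mean01_total_energy (R : realType) (J : nat) :
  exists2 v : R, mean01 (total_energy J) v & v <= (4 * J)%:R * (J.+1%:R * 2 ^+ J).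
Proof.
exists (\sum_(m < 2 ^ (4 * J)) m%:R^-1 * (J.+1%:R * 2 ^+ J)); last first.
  by rewrite -mulr_suml ler_wpM2r ?mulr_ge0 ?exprn_ge0// harmonic_le.
apply: mean01_sum => m _; case: (posnP m) => [->|m0].
  rewrite invr0 mul0r; apply: mean01_ext (@mean01_0 R) => x.
  by rewrite mul0r.
by apply: mean01Z; exact: mean01_dyadic_energy.
Qed.

Lemma expsum_energy_le (R : realType) (a : R) (N J : nat) : (N <= 2 ^ J)%N ->
  expsum_energy (fun x : 'I_N => e (a * x.+1%:R ^+ 2)) (N ^ 4) <= J.+1%:R * total_energy J a.
Proof.
move=> NJ; rewrite /expsum_energy /total_energy mulr_sumr.
have le4 : (N ^ 4 <= 2 ^ (4 * J))%N by rewrite mulnC expnM leq_exp2r.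
pose z (x : 'I_N) := e (a * x.+1%:R ^+ 2).
have zE m : normc (expsum z m) ^+ 2 = 
    (\sum_(1 <= x < 1 + N) cosw a m x) ^+ 2 + (\sum_(1 <= x < 1 + N) sinw a m x) ^+ 2.
  have -> : expsum z m = Complex (\sum_(1 <= x < 1 + N) cosw a m x) (\sum_(1 <= x < 1 + N) sinw a m x).
    have sumE (f g : nat -> R) (s : seq nat) : \sum_(x <- s) Complex (f x) (g x) = Complex (\sum_(x <- s) f x) (\sum_(x <- s) g x).
      by elim: s => [|y s IH]; rewrite ?big_nil// !big_cons IH.
    rewrite -sumE -{1}[1%N]add0n big_addn addKn big_mkord; apply: eq_bigr => x _.
    rewrite /z -e_mulrn /e /cosw /sinw addn1 -pmulrn natrM natrX.
    by congr (Complex (cos _) (sin _)); ring.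
  by rewrite /= sqr_sqrtr// addr_ge0// sqr_ge0.
rewrite (big_ord_widen _ (fun m => normc (expsum z m) ^+ 2 / m%:R) le4).
rewrite big_mkcond/=; apply: ler_sum => m _.
have D0 : 0 <= dyadic_energy (cosw a m) J 1 + dyadic_energy (sinw a m) J 1.
  by rewrite addr_ge0// dyadic_energy_ge0.
case: ifP => _; last by rewrite !mulr_ge0// invr_ge0.
rewrite mulrCA mulrC ler_wpM2l ?invr_ge0// zE mulrDr lerD//; exact: dyadic_maximal.
Qed.

(** Markov's inequality, with mean at most 4 J (J + 1) 2^J, gives 4 J / (J + 1)^3. The exponent 4 in
    the threshold makes this summable, and the stated bound is chosen to telescope. *)
Lemma total_energy_tail (R : realType) (J : nat) :
  (@lebesgue_measure R (`[0%R, 1%R] `&`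
     [set a | (2 ^+ J * J.+1%:R ^+ 4 <= total_energy J a)%R]) <= (8 / (J.+1%:R * J.+2%:R))%:E)%E.
Proof.
set mu := @lebesgue_measure R; set T : R := 2 ^+ J * J.+1%:R ^+ 4.
have T0 : 0 < T by rewrite mulr_gt0// exprn_gt0.
have [v [cZ vE] vle] := @mean01_total_energy R J.
have iZ := continuous_integrable01 cZ.
have := @le_integral_comp_abse _ _ _ mu `[0%R, 1%R] (measurable_itv _) (EFin \o total_energy J) T id
  (@measurable_id _ _ setT) (fun r h => h) (fun x y _ _ h => h) (measurable_int _ iZ) T0.
have -> : [set x | (T%:E <= `|(EFin \o total_energy J) x|)%E] = [set a | T <= total_energy J a].
  by apply/seteqP; split => a /=; rewrite lee_fin ger0_norm// total_energy_ge0.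
have -> : (\int[mu]_(x in `[0%R, 1%R]) `|(EFin \o total_energy J) x| = v%:E)%E.
  rewrite -vE /Rintegral fineK; last exact: integrable_fin_num.
  by apply: eq_integral => x _ /=; rewrite ger0_norm// total_energy_ge0.
rewrite -lee_pdivlMl// => /le_trans; apply; rewrite -EFinM lee_fin.
have J1 : 0 < J.+1%:R :> R by [].
have J2 : 0 < J.+2%:R :> R by [].
rewrite ler_pdivlMr ?mulr_gt0// -mulrA ler_pdivrMl//.
have p2 : 0 < 2 ^+ J :> R by rewrite exprn_gt0.
apply: (le_trans (y := (4 * J)%:R * (J.+1%:R * 2 ^+ J) * (J.+1%:R * J.+2%:R))).
  by rewrite ler_wpM2r// mulr_ge0.
rewrite /T; have -> : J.+2%:R = J.+1%:R + 1 :> R by rewrite -natr1.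
have -> : (4 * J)%:R = 4 * (J.+1%:R - 1) :> R by rewrite natrM -[J.+1%:R]natr1 addrK.
set k : R := J.+1%:R.
have -> : 4 * (k - 1) * (k * 2 ^+ J) * (k * (k + 1)) = 2 ^+ J * k ^+ 2 * (4 * (k ^+ 2 - 1)) by ring.
have -> : 2 ^+ J * k ^+ 4 * 8 = 2 ^+ J * k ^+ 2 * (8 * k ^+ 2) by ring.
rewrite ler_wpM2l ?mulr_ge0 ?exprn_ge0 ?(ltW p2)//.
have := sqr_ge0 k; lra.
Qed.

(** The only property of alpha used in the sequel. It mentions no window, test function or
    tolerance, so one null set serves them all. *)
Definition good_energy (R : realType) (a : R) : Prop :=
  exists J0, forall J, (J0 <= J)%N -> total_energy J a <= 2 ^+ J * J.+1%:R ^+ 4.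

Lemma ae_total_energy (R : realType) :
  {ae @lebesgue_measure R, forall a : R, 0 <= a <= 1 -> good_energy a}.
Proof.
set mu := @lebesgue_measure R.
pose F J : set R := `[0%R, 1%R] `&` [set a | (2 ^+ J * J.+1%:R ^+ 4 <= total_energy J a)%R].
have mF J : measurable (F J).
  have [v [cZ _] _] := @mean01_total_energy R J.
  have mZ := measurable_int _ (continuous_integrable01 cZ).
  exact: (emeasurable_fun_c_infty (measurable_itv _) mZ (2 ^+ J * J.+1%:R ^+ 4)%:E).
have sF : (\sum_(J <oo) mu (F J) < +oo)%E.
  apply: (@le_lt_trans _ _ 8%:E); last exact: ltry.
  apply: lime_le; first exact: is_cvg_nneseries.
  apply: nearW => n.
  apply: (@le_trans _ _ (\sum_(0 <= J < n) (8 / (J.+1%:R * J.+2%:R))%:E)%E).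
    by apply: lee_sum => J _; exact: total_energy_tail.
  rewrite sumEFin lee_fin.
  have -> : \sum_(0 <= J < n) 8 / (J.+1%:R * J.+2%:R) = 8 * (1 - n.+1%:R^-1) :> R.
    elim: n => [|n IH]; first by rewrite big_geq// invr1 subrr mulr0.
    rewrite big_nat_recr//= IH -[n.+2%:R]natr1.
    have : 0 < n.+1%:R :> R by [].
    move: (n.+1%:R : R) => k k0; field; rewrite !gt_eqF//; lra.
  by rewrite ler_piMr// gerBl invr_ge0.
have F0 := @lim_sup_set_cvg0 _ _ _ (@lebesgue_measure R) F mF sF.
exists (lim_sup_set F); split => //.
  by apply: bigcapT_measurable => k; apply: bigcup_measurable => j _; exact: mF.
move=> a /= na J0 _; apply: contrapT => nJ; apply: na => a01.
exists J0 => J J0J; rewrite leNgt; apply/negP => h; apply: nJ.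
by exists J => //; split; rewrite /= ?in_itv//= ltW.
Qed.

(** * Triples in boxes *)

Lemma powR_ge1 (R : realType) (x r : R) : 1 <= x -> 0 <= r -> 1 <= x `^ r.
Proof. by move=> x1 r0; have := ler_powR x1 r0; rewrite powRr0. Qed.

(** Bernoulli's inequality for b = 2^eps > 1: if j + 1 is the rounded-up logarithm then 2^j < N, so
    1 + j (b - 1) <= b^j <= N^eps. *)
Lemma up_log_powR (R : realType) (eps : R) : 0 < eps ->
  exists2 c : R, 0 < c & forall N, (0 < N)%N -> (up_log 2 N).+1%:R <= c * N%:R `^ eps.
Proof.
move=> e0; pose b : R := 2 `^ eps.
have b1 : 1 < b.
  have := @gt0_ltr_powR R eps e0 1 2; rewrite powR1; apply; rewrite ?nnegrE//.
  by rewrite ltr1n.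
have bern n : 1 + n%:R * (b - 1) <= b ^+ n.
  elim: n => [|n IH]; first by rewrite mul0r addr0.
  have n0 : 0 <= n%:R :> R by [].
  have b0 : 0 <= b by lra.
  have h1 := ler_wpM2l b0 IH; have h2 := mulr_ge0 n0 (sqr_ge0 (b - 1)).
  by rewrite -natr1 exprS; lra.
pose c := 2 + (b - 1)^-1; have b10 : 0 < b - 1 by rewrite subr_gt0.
have c0 : 0 < c by rewrite addr_gt0// invr_gt0.
exists c => // N N0.
have X1 : 1 <= N%:R `^ eps.
  by rewrite powR_ge1 ?(ltW e0)// ler1n.
case J : (up_log 2 N) => [|j].
  by apply: le_trans (ler_peMr (ltW c0) X1); rewrite /c; have := invr_gt0 (b - 1); lra.
have N1 : (1 < N)%N by case: (N) N0 J => [//|[|//]] _; rewrite up_log1.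
have := up_log_gtn (isT : 1 < 2)%N N1; rewrite J/= => jN.
have bX : b ^+ j <= N%:R `^ eps.
  rewrite /b -powR_mulrn ?powR_ge0// powRAC powR_mulrn// -natrX.
  by apply: ge0_ler_powR; rewrite ?(ltW e0) ?nnegrE ?ler_nat ?(ltnW jN).
have h := bern j; set X := N%:R `^ eps in X1 bX *.
have h2 : j%:R <= X / (b - 1) by rewrite ler_pdivlMr//; lra.
rewrite -addn2 natrD /c mulrDl [_^-1 * X]mulrC; lra.
Qed.

(** Using exponent eps / 11 bounds the eleventh power of the logarithm by c^11 N^eps; the eleventh
    factor, itself unbounded, absorbs [K] and c^11. The power 10 is the square of the power 5 in the
    energy bound. *)
Lemma polylog_le_powR (R : realType) (eps K : R) : 0 < eps ->
  exists N0, forall N, (N0 <= N)%N ->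
    (0 < N)%N /\ K * (up_log 2 N).+1%:R ^+ 10 <= N%:R `^ eps.
Proof.
move=> e0; have e11 : 0 < eps / 11 by rewrite divr_gt0.
have [c c0 hc] := up_log_powR e11.
pose n := (Num.truncn (K * c ^+ 11)).+1.
exists (2 ^ n)%N => N nN.
have N0 : (0 < N)%N by apply: leq_trans nN; rewrite expn_gt0.
split => //; have := leq_up_log 2 nN; rewrite up_expnK// => nJ.
have := hc N N0; set J : R := (up_log 2 N).+1%:R; set Y := _ `^ _ => JY.
have Y0 : 0 < Y by rewrite powR_gt0// ltr0n.
have XE : N%:R `^ eps = Y ^+ 11.
  by rewrite -powR_mulrn ?(ltW Y0)// /Y -powRrM divfK.
have J0 : 0 < J by rewrite ltr0n.
have KJ : K * c ^+ 11 <= J.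
  apply: (le_trans (ltW (truncnS_gt _))); rewrite ler_nat.
  by apply: leq_trans nJ _.
have JY11 : J ^+ 11 <= (c * Y) ^+ 11.
  by apply: lerXn2r => //; rewrite nnegrE ?mulr_ge0 ?ltW.
rewrite XE; rewrite exprMn in JY11.
have c11 : 0 < c ^+ 11 by rewrite exprn_gt0.
rewrite -(ler_pM2l c11); apply: le_trans JY11.
rewrite mulrA [c ^+ 11 * K]mulrC exprS.
by apply: ler_wpM2r => //; rewrite exprn_ge0// ltW.
Qed.

Lemma le_powR_eventually (R : realType) (eps K : R) : 0 < eps ->
  exists N0, forall N, (N0 <= N)%N -> (0 < N)%N /\ K <= N%:R `^ eps.
Proof.
move=> e0; have [N0 h] := polylog_le_powR `|K| e0; exists N0 => N /h [N1 hN]; split => //.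
apply: le_trans (ler_norm K) _; apply: le_trans hN; rewrite ler_peMr//.
by rewrite exprn_ege1// ler1n.
Qed.

(* The ordinal [x] of ['I_N] stands for the integer [x + 1]. *)
Definition point (R : realType) (a : R) (N : nat) (x : 'I_N) : R := a * x.+1%:R ^+ 2.

Lemma count_variance_small (R : realType) (eps a w delta : R) : 0 < eps -> 0 < delta -> 0 <= w ->
  good_energy a ->
  exists N0 : nat, forall (N : nat) (L u v : R) (P : 'I_N -> pred 'I_N), (N0 <= N)%N ->
    N%:R `^ (4^-1 + eps) < L -> L < N%:R `^ (1 - eps) -> u <= v -> v - u = w * L / N%:R ->
    (forall y x, P y x -> exists n : int, u <= point a x - point a y - n%:~R <= v) ->
    (forall y x, (exists n : int, u < point a x - point a y - n%:~R < v) -> P y x) ->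
    \sum_y (#|P y|%:R - w * L) ^+ 2 <= delta * (N%:R * L ^+ 2).
Proof.
move=> e0 d0 w0 [J0 goodJ].
(* The 4 comes from P1^2 = 4 (J + 1)^10. The 194 is 48 + 98 + 48: from 16 * 3 and the additive 98 in
   the variance bound, and from 16 (2 + 1) in the off-diagonal term. *)
have [N1 hN1] := @polylog_le_powR R eps (4 * (16 * w + 194) / delta) e0.
have [N2 hN2] := @le_powR_eventually R eps (2 * w) e0.
exists (maxn (2 ^ J0) (maxn 10 (maxn N1 N2))) => N L u v P.
rewrite !geq_max => /and4P[NJ N10 NN1 NN2] Llo Lhi uv vuE PU PL.
have [N0 hK] := hN1 N NN1; have [_ hw] := hN2 N NN2.
set J := up_log 2 N in hK.
have J0J : (J0 <= J)%N by rewrite -(@up_expnK 2 J0)// leq_up_log.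
have NJ2 : (N <= 2 ^ J)%N by exact: up_logP.
have JN2 : (2 ^ J <= 2 * N)%N.
  have N1' : (1 < N)%N by apply: leq_trans N10.
  have := up_log_gtn (isT : 1 < 2)%N N1'; rewrite -/J => h.
  have J1 : (0 < J)%N by rewrite /J up_log_gt0.
  by rewrite -(prednK J1) expnS leq_pmul2l// ltnW.
have NR : 0 < N%:R :> R by rewrite ltr0n.
set X := N%:R `^ eps in hK hw.
have X0 : 0 < X by rewrite powR_gt0.
(* The value of [lam] that balances lam H against G / lam, both of order sqrt N up to logarithms. *)
pose s := Num.sqrt (N%:R : R).
have s0 : 0 < s by rewrite sqrtr_gt0.
have ss : s ^+ 2 = N%:R by rewrite sqr_sqrtr ?ltW.
have N1R : 1 <= N%:R :> R by rewrite ler1n.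
have X1 : 1 <= X by rewrite powR_ge1// ltW.
(* The first inequality beats the diagonal term N L, the second the off-diagonal term N^(3/2); the
   exponent 1/4 enters through the second. *)
have LX : X < L /\ X * s <= L ^+ 2.
  rewrite powRD in Llo; last by rewrite (gt_eqF NR) implybT.
  rewrite -/X in Llo; set q := N%:R `^ 4^-1 in Llo.
  have q1 : 1 <= q by rewrite powR_ge1// invr_ge0.
  have qs : q ^+ 2 = s.
    rewrite -powR_mulrn ?powR_ge0// -powRrM /s -powR12_sqrt ?ltW//; congr (_ `^ _); lra.
  split.
    by apply: le_lt_trans Llo; rewrite ler_peMl// ltW.
  have q0 : 0 < q by lra.
  apply: (le_trans (y := (q * X) ^+ 2)); last first.
    by rewrite !expr2; apply: ler_pM; rewrite ?mulr_ge0 ?(ltW X0) ?(ltW q0) ?(ltW Llo).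
  have X10 : 0 <= X - 1 by lra.
  have := mulr_ge0 (mulr_ge0 (ltW s0) (ltW X0)) X10; rewrite exprMn qs; lra.
have [XL Xs] := LX; have L0 : 0 < L by apply: lt_trans XL.
(* The power 5 is 4 from the threshold plus 1 from the maximal inequality; the 2 comes from 2^J <= 2
   N. *)
pose P1 : R := 2 * J.+1%:R ^+ 5.
have J1R : 1 <= J.+1%:R :> R by rewrite ler1n.
have J51 : 1 <= J.+1%:R ^+ 5 :> R by rewrite exprn_ege1.
have P11 : 1 <= P1 by rewrite /P1; lra.
have vu2 : v - u <= 2^-1.
  have LN : L * X <= N%:R.
    move: (ltW Lhi); rewrite powRB; last by rewrite (gt_eqF NR) implybT.
    by rewrite (powRr1 (ltW NR)) ler_pdivlMr.
  rewrite vuE ler_pdivrMr// ; nra.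
have := @count_variance R 'I_N (@point R a N) P u v s; rewrite !card_ord.
move=> /(_ N10 s0 uv vu2 PU PL).
have -> : N%:R * (v - u) = w * L by rewrite vuE mulrC divfK// gt_eqF.
move=> /le_trans; apply.
set G := expsum_energy _ _; set H := \sum_(m < N ^ 4) _.
have G0 : 0 <= G by apply: sumr_ge0 => m _; rewrite divr_ge0// exprn_ge0// normc_ge0.
have GP : G <= N%:R * P1.
  apply: le_trans (expsum_energy_le a NJ2) _.
  apply: (le_trans (y := J.+1%:R * (2 ^+ J * J.+1%:R ^+ 4))).
    by rewrite ler_wpM2l// goodJ.
  have -> : J.+1%:R * (2 ^+ J * J.+1%:R ^+ 4) = 2 ^+ J * J.+1%:R ^+ 5 :> R by ring.
  have -> : N%:R * P1 = (2 * N%:R) * J.+1%:R ^+ 5 by rewrite /P1; ring.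
  by rewrite ler_wpM2r ?exprn_ge0// -natrX -natrM ler_nat.
have HP : H <= 2 * P1.
  apply: (le_trans (y := (4 * J)%:R)).
    apply: le_trans (harmonic_le R (4 * J)).
    have le4 : (N ^ 4 <= 2 ^ (4 * J))%N by rewrite mulnC expnM leq_exp2r.
    rewrite /H (big_ord_widen _ (fun m => m%:R^-1) le4) big_mkcond/=.
    by apply: ler_sum => m _; case: ifP => // _; rewrite invr_ge0.
  rewrite natrM /P1; have : J%:R <= J.+1%:R ^+ 5 :> R.
    apply: (le_trans (y := J.+1%:R)); first by rewrite ler_nat.
    by rewrite exprS ler_peMr// exprn_ege1.
  lra.
have H0 : 0 <= H by apply: sumr_ge0 => m _; rewrite invr_ge0.
have K2 : (16 * w + 194) * P1 ^+ 2 <= delta * X.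
  have -> : (16 * w + 194) * P1 ^+ 2 = delta * (4 * (16 * w + 194) / delta * J.+1%:R ^+ 10).
    by rewrite /P1; field; rewrite gt_eqF.
  by rewrite ler_pM2l.
set g := G / s; have gP : g <= s * P1.
  by rewrite ler_pdivrMr// mulrAC -expr2 ss.
have g0 : 0 <= g by rewrite divr_ge0// ltW.
have sHP : s * H <= s * (2 * P1) by rewrite ler_wpM2l// ltW.
have wL0 : 0 <= w * L by rewrite mulr_ge0// ltW.
have P1sq : P1 <= P1 ^+ 2 by rewrite expr2 ler_peMr//; lra.
have t1 : 16 * (w * L + 3) * G <= 16 * (w * L + 3) * (N%:R * P1 ^+ 2).
  rewrite ler_wpM2l ?mulr_ge0 ?addr_ge0//; apply: le_trans GP _.
  by rewrite ler_wpM2l// ltW.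
have t2 : 16 * (s * H + g) * G <= 48 * s * (N%:R * P1 ^+ 2).
  have -> : 48 * s * (N%:R * P1 ^+ 2) = (16 * (s * (2 * P1) + s * P1)) * (N%:R * P1) by ring.
  apply: ler_pM => //; first by rewrite mulr_ge0// addr_ge0// mulr_ge0// ltW.
  by rewrite ler_wpM2l// lerD.
set M := N%:R * P1 ^+ 2 in t1 t2.
have NM : N%:R <= M by rewrite ler_peMr ?(ltW NR)//; lra.
have M0 : 0 <= M by lra.
have XLL : X * L <= L ^+ 2 by rewrite expr2 ler_wpM2r// ltW.
apply: (le_trans (y := M * ((16 * w + 146) * L + 48 * s))).
  have : M * 1 <= M * L by rewrite ler_wpM2l//; lra.
  have := ler_wpM2l M0 wL0; lra.
rewrite -(ler_pM2l X0).
apply: (le_trans (y := M * ((16 * w + 194) * L ^+ 2))).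
  have -> : X * (M * ((16 * w + 146) * L + 48 * s)) = M * ((16 * w + 146) * (X * L) + 48 * (X * s)) by ring.
  rewrite ler_wpM2l//.
  have : (16 * w + 146) * (X * L) <= (16 * w + 146) * L ^+ 2 by rewrite ler_wpM2l// addr_ge0// mulr_ge0.
  lra.
have -> : M * ((16 * w + 194) * L ^+ 2) = (16 * w + 194) * P1 ^+ 2 * (N%:R * L ^+ 2) by rewrite /M; ring.
have -> : X * (delta * (N%:R * L ^+ 2)) = delta * X * (N%:R * L ^+ 2) by ring.
by apply: ler_wpM2r => //; rewrite mulr_ge0// exprn_ge0// ltW.
Qed.

Lemma powR_range (R : realType) (eps L : R) (N : nat) : 0 < eps -> (0 < N)%N ->
  N%:R `^ (4^-1 + eps) < L -> L < N%:R `^ (1 - eps) ->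
  N%:R `^ eps < L /\ L * N%:R `^ eps < N%:R.
Proof.
move=> e0 N0 Llo Lhi; have NR : 0 < N%:R :> R by rewrite ltr0n.
have N1R : 1 <= N%:R :> R by rewrite ler1n.
split.
  by apply: le_lt_trans Llo; apply: ler_powR => //; rewrite lerDr invr_ge0.
move: Lhi; rewrite powRB; last by rewrite (gt_eqF NR) implybT.
by rewrite (powRr1 (ltW NR)) ltr_pdivlMr// powR_gt0.
Qed.

(** Half-open, so that adjacent grid cells tile without overlap. *)
Definition in_window (R : realType) (b1 b2 t : R) : bool := b1 <= t < b2.

(** Both orders of the difference are needed: the middle point is subtracted in the first argument
    of g and is the minuend in the second. *)
Lemma sgn_frac_count (R : realType) (eps a b1 b2 delta : R) : 0 < eps -> 0 < delta -> b1 <= b2 ->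
  good_energy a ->
  exists N0 : nat, forall (N : nat) (L : R), (N0 <= N)%N ->
    N%:R `^ (4^-1 + eps) < L -> L < N%:R `^ (1 - eps) ->
    \sum_(y < N) (#|[pred x : 'I_N | in_window b1 b2 (N%:R / L * sgn_frac (point a x - point a y))]|%:R
       - (b2 - b1) * L) ^+ 2 <= delta * (N%:R * L ^+ 2) /\
    \sum_(y < N) (#|[pred x : 'I_N | in_window b1 b2 (N%:R / L * sgn_frac (point a y - point a x))]|%:R
       - (b2 - b1) * L) ^+ 2 <= delta * (N%:R * L ^+ 2).
Proof.
move=> e0 d0 b12 good; have w0 : 0 <= b2 - b1 by rewrite subr_ge0.
have [N1 hN1] := count_variance_small e0 d0 w0 good.
have [N2 hN2] := @le_powR_eventually R eps (2 * (`|b1| + `|b2| + 1)) e0.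
exists (maxn N1 N2) => N L; rewrite geq_max => /andP[NN1 NN2] Llo Lhi.
have [N0 hX] := hN2 N NN2; have [XL LX] := powR_range e0 N0 Llo Lhi.
have NR : 0 < N%:R :> R by rewrite ltr0n.
set X := _ `^ eps in hX XL LX.
have X0 : 0 < X by rewrite powR_gt0.
have L0 : 0 < L by apply: lt_trans XL.
pose r := L / N%:R; have r0 : 0 < r by rewrite divr_gt0.
have rX : r * X < 1 by rewrite /r mulrAC ltr_pdivrMr// mul1r.
(* Scaled endpoints lie strictly inside (-1/2, 1/2), so a representative of the difference found in
   the window must be the signed fractional part. *)
have rb b : `|b| <= `|b1| + `|b2| -> - 2^-1 < b * r < 2^-1.
  move=> hb; have h1 : `|b| * r <= (`|b1| + `|b2|) * r by rewrite ler_wpM2r// ltW.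
  have h2 : 2 * (`|b1| + `|b2| + 1) * r <= X * r by rewrite ler_wpM2r// ltW.
  rewrite -ltr_norml normrM (gtr0_norm r0).
  by move: h1 h2 rX r0; lra.
have winE t c1 c2 : in_window c1 c2 (N%:R / L * t) = (c1 * r <= t < c2 * r).
  rewrite /in_window /r; have -> : N%:R / L * t = t / (L / N%:R) by field; rewrite !gt_eqF.
  by rewrite ler_pdivlMr// ltr_pdivrMr.
have nb1 : `|b1| <= `|b1| + `|b2| by rewrite lerDl.
have nb2 : `|b2| <= `|b1| + `|b2| by rewrite lerDr.
have /andP[l1 u1] := rb _ nb1; have /andP[l2 u2] := rb _ nb2.
have b12r : b1 * r <= b2 * r by rewrite ler_wpM2r// ltW.
have sgnE (s : R) : exists n : int, sgn_frac s = s - n%:~R by exists (Num.ceil (s - 2^-1)).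
split.
  apply: (hN1 N L (b1 * r) (b2 * r) (fun y => [pred x : 'I_N | _])) => //.
  - by rewrite /r -mulrBl mulrA.
  - move=> y x /=; rewrite winE => /andP[h1 h2].
    have [n hn] := sgnE (point a x - point a y); exists n; rewrite -hn h1/=; exact: ltW.
  - move=> y x [n] /andP[h1 h2] /=; rewrite winE.
    have <- : point a x - point a y - n%:~R = sgn_frac (point a x - point a y).
      by apply: (@sgn_frac_unique _ _ _ n); rewrite ?subrK//; apply/andP; split; lra.
    by rewrite (ltW h1).
(* Negating the difference reflects the window, which becomes open on the left and closed on the
   right. *)
apply: (hN1 N L (- b2 * r) (- b1 * r) (fun y => [pred x : 'I_N | _])) => //.
- by rewrite !mulNr lerN2.
- by rewrite /r -mulrBl mulrA opprK addrC.
- move=> y x /=; rewrite winE => /andP[h1 h2].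
  have [n hn] := sgnE (point a y - point a x); exists (- n); rewrite mulrNz.
  by move: h1 h2; rewrite hn; set q := n%:~R; set p1 := point a y; set p2 := point a x => h1 h2; lra.
- move=> y x [n] /andP[h1 h2] /=; rewrite winE.
  have <- : point a y - point a x + n%:~R = sgn_frac (point a y - point a x).
    apply: (@sgn_frac_unique _ _ _ (- n)); rewrite ?mulrNz ?addrK//.
    by move: h1 h2; set q := n%:~R; set p1 := point a y; set p2 := point a x => h1 h2; lra.
  by move: h1 h2; set q := n%:~R; set p1 := point a y; set p2 := point a x => h1 h2; lra.
Qed.

(** Coincident indices are included, so that for a product function the sums over x and z factor at
    each y. *)
Definition triple_sum (R : realType) (a L : R) (N : nat) (f : R -> R -> R) : R :=
  \sum_(y < N) \sum_(x < N) \sum_(z < N)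
    f (N%:R / L * sgn_frac (point a x - point a y)) (N%:R / L * sgn_frac (point a y - point a z)).

Definition box (R : realType) (b1 b2 c1 c2 s t : R) : R :=
  (in_window b1 b2 s)%:R * (in_window c1 c2 t)%:R.

(** Writing S = w L + E and S' = w' L + E', the cross terms are bounded by 2 |u v| <= eta u^2 + v^2
    / eta, which turns a variance eta^2 N L^2 into an error eta N L^2. The product E E' is covered
    by eta^2 <= eta. *)
Lemma sum_product_deviation (R : realType) (N : nat) (S S' : 'I_N -> R) (w w' L eta : R) :
  0 < eta <= 1 -> 0 <= w -> 0 <= w' -> 0 <= L ->
  \sum_y (S y - w * L) ^+ 2 <= eta ^+ 2 * (N%:R * L ^+ 2) ->
  \sum_y (S' y - w' * L) ^+ 2 <= eta ^+ 2 * (N%:R * L ^+ 2) ->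
  `|\sum_y S y * S' y - w * w' * (N%:R * L ^+ 2)| <= (w + w' + 1) * eta * (N%:R * L ^+ 2).
Proof.
move=> /andP[eta0 eta1] w0 w'0 L0 hS hS'.
have -> : w * w' * (N%:R * L ^+ 2) = \sum_(y < N) w * w' * L ^+ 2.
  by rewrite sumr_const card_ord -[RHS]mulr_natl; ring.
rewrite -sumrB; apply: le_trans (ler_norm_sum _ _ _) _.
pose E y := S y - w * L; pose E' y := S' y - w' * L.
have pt y : `|S y * S' y - w * w' * L ^+ 2| <=
    w * (eta * L ^+ 2 + E' y ^+ 2 / eta) / 2 + w' * (eta * L ^+ 2 + E y ^+ 2 / eta) / 2
    + (E y ^+ 2 + E' y ^+ 2) / 2.
  have amgm (u v : R) : `|u * v| <= (eta * u ^+ 2 + v ^+ 2 / eta) / 2.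
    rewrite ler_norml; apply/andP; split.
      have : 0 <= (eta * u + v) ^+ 2 / eta by rewrite divr_ge0 ?sqr_ge0// ltW.
      have -> : (eta * u + v) ^+ 2 / eta = eta * u ^+ 2 + 2 * (u * v) + v ^+ 2 / eta.
        by field; rewrite gt_eqF.
      lra.
    have : 0 <= (eta * u - v) ^+ 2 / eta by rewrite divr_ge0 ?sqr_ge0// ltW.
    have -> : (eta * u - v) ^+ 2 / eta = eta * u ^+ 2 - 2 * (u * v) + v ^+ 2 / eta.
      by field; rewrite gt_eqF.
    lra.
  have -> : S y * S' y - w * w' * L ^+ 2 = w * (L * E' y) + w' * (L * E y) + E y * E' y.
    by rewrite /E /E'; ring.
  apply: le_trans (ler_normD _ _) _; apply: lerD.
    apply: le_trans (ler_normD _ _) _.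
    by rewrite !normrM !(ger0_norm w0) !(ger0_norm w'0) -!normrM lerD// -mulrA ler_wpM2l.
  have h1 := sqr_ge0 (E y - E' y); have h2 := sqr_ge0 (E y + E' y).
  by rewrite ler_norml; move: (E y) (E' y) h1 h2 => p q h1 h2; apply/andP; split; nra.
apply: le_trans (ler_sum _ (fun y _ => pt y)) _.
rewrite !big_split/= -!mulr_suml -!mulr_sumr !big_split/= -!mulr_suml.
rewrite sumr_const card_ord -/(\sum_y E y ^+ 2) -/(\sum_y E' y ^+ 2).
have -> : eta *+ N * L ^+ 2 = eta * (N%:R * L ^+ 2) by rewrite -[X in X * _]mulr_natl; ring.
move: hS hS'; rewrite -/(\sum_y E y ^+ 2) -/(\sum_y E' y ^+ 2).
set V := \sum_y E y ^+ 2; set V' := \sum_y E' y ^+ 2; set M := N%:R * L ^+ 2 => hV hV'.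
have M0 : 0 <= M by rewrite mulr_ge0 ?exprn_ge0.
have div (v : R) : v <= eta ^+ 2 * M -> v / eta <= eta * M.
  by move=> h; rewrite ler_pdivrMr// mulrAC -expr2.
have e1 : w * (eta * M + V' / eta) <= w * (2 * (eta * M)).
  by rewrite ler_wpM2l//; have := div _ hV'; lra.
have e2 : w' * (eta * M + V / eta) <= w' * (2 * (eta * M)).
  by rewrite ler_wpM2l//; have := div _ hV; lra.
have e3 : eta ^+ 2 * M <= eta * M by rewrite ler_wpM2r// expr2 ler_piMl// ltW.
lra.
Qed.

Lemma triple_sum_box (R : realType) (a L b1 b2 c1 c2 : R) (N : nat) :
  triple_sum a L N (box b1 b2 c1 c2) =
  \sum_(y < N) 
     #|[pred x : 'I_N | in_window b1 b2 (N%:R / L * sgn_frac (point a x - point a y))]|%:R *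
     #|[pred x : 'I_N | in_window c1 c2 (N%:R / L * sgn_frac (point a y - point a x))]|%:R.
Proof.
apply: eq_bigr => y _; rewrite !natr_card mulr_suml; apply: eq_bigr => x _.
by rewrite mulr_sumr.
Qed.

Lemma triple_sum_box_asymp (R : realType) (eps a b1 b2 c1 c2 delta : R) :
  0 < eps -> 0 < delta -> b1 <= b2 -> c1 <= c2 ->
  good_energy a ->
  exists N0 : nat, forall (N : nat) (L : R), (N0 <= N)%N ->
    N%:R `^ (4^-1 + eps) < L -> L < N%:R `^ (1 - eps) ->
    `|triple_sum a L N (box b1 b2 c1 c2) - (b2 - b1) * (c2 - c1) * (N%:R * L ^+ 2)|
      <= delta * (N%:R * L ^+ 2).
Proof.
move=> e0 d0 b12 c12 good.
have w0 : 0 <= b2 - b1 by rewrite subr_ge0.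
have w'0 : 0 <= c2 - c1 by rewrite subr_ge0.
pose K := b2 - b1 + (c2 - c1) + 1; have K0 : 0 < K by rewrite /K; lra.
pose eta := Num.min 1 (delta / K).
have eta0 : 0 < eta by rewrite lt_min ltr01 divr_gt0.
have etaK : K * eta <= delta by rewrite mulrC -ler_pdivlMr// ge_min lexx orbT.
have eta2 : 0 < eta ^+ 2 by rewrite exprn_gt0.
have [N1 h1] := sgn_frac_count e0 eta2 b12 good.
have [N2 h2] := sgn_frac_count e0 eta2 c12 good.
exists (maxn N1 N2) => N L; rewrite geq_max => /andP[NN1 NN2] Llo Lhi.
have L0 : 0 <= L by apply/ltW/(le_lt_trans _ Llo)/powR_ge0.
have [d1 _] := h1 N L NN1 Llo Lhi; have [_ d2] := h2 N L NN2 Llo Lhi.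
have eta01 : 0 < eta <= 1 by rewrite eta0 ge_min lexx.
rewrite triple_sum_box; apply: le_trans (sum_product_deviation eta01 w0 w'0 L0 d1 d2) _.
by apply: ler_wpM2r => //; rewrite mulr_ge0// exprn_ge0.
Qed.

(** * Step functions *)

Lemma window_telescope (R : realType) (c : nat -> R) m (t : R) : (forall i, c i <= c i.+1) ->
  \sum_(i < m) (in_window (c i) (c i.+1) t)%:R = (in_window (c 0%N) (c m) t)%:R :> R.
Proof.
rewrite /in_window => cm; elim: m => [|m IH].
  by rewrite big_ord0; case: (boolP (_ <= t < _)) => // /andP[/le_lt_trans h /h]; rewrite ltxx.
rewrite big_ord_recr/= IH.
have c0m : c 0%N <= c m.
  by elim: (m) => // n; move=> /le_trans; apply.
have := cm m => cmS.
have [t0|t0] := leP (c 0%N) t; last first.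
  rewrite add0r; case: (leP (c m) t) => //= ?; have : c 0%N <= t by apply: le_trans c0m _.
  by rewrite leNgt t0.
have [tm|tm] := ltP t (c m); rewrite /=.
  by rewrite (lt_le_trans tm cmS) addr0.
by rewrite add0r.
Qed.

(** Compactness gives a [d] valid when the first point is in the support and the second arbitrary.
    Symmetry handles the second point in the support, and both values vanish when neither is. *)
Lemma unif_continuous_compact_support (R : realType) (g : R * R -> R) (om : R) :
  continuous g -> compactly_supported g -> 0 < om ->
  exists2 d : R, 0 < d & forall x y : R * R, `|x.1 - y.1| < d -> `|x.2 - y.2| < d ->
    `|g x - g y| <= om.
Proof.
move=> cg sg om0; rewrite /compactly_supported in sg; set K := closure _ in sg.
have om2 : 0 < om / 2 by rewrite divr_gt0.
have /compact_near_coveringP nc := sg.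
pose P (d : R) (x : R * R) := forall y : R * R, `|x.1 - y.1| < d -> `|x.2 - y.2| < d -> `|g x - g y| <= om.
have near0 : \forall d \near (0 : R)^'+, K `<=` P d.
  apply: nc => x Kx.
  have /cvgrPdist_lt /(_ _ om2) := cg x.
  rewrite -nbhs_ballE => -[r r0 hr].
  have r2 : 0 < r / 2 by rewrite divr_gt0.
  exists (ball x (r / 2), [set d : R | 0 < d < r / 2]).
    split => /=; first exact: nbhsx_ballx.
    near=> d; apply/andP; split; near: d; first exact: nbhs_right_gt.
    exact: nbhs_right_lt.
  move=> [x' d] [/= [bx1 bx2] /andP[d0 dr]] y y1 y2.
  move: bx1 bx2; rewrite /ball/= => bx1 bx2.
  have h1 : `|g x - g x'| < om / 2.
    by apply: hr; split; rewrite /ball/=; lra.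
  have h2 : `|g x - g y| < om / 2.
    apply: hr; split; rewrite /ball/=.
      by have := ler_normD (x.1 - x'.1) (x'.1 - y.1); rewrite addrA subrK; lra.
    by have := ler_normD (x.2 - x'.2) (x'.2 - y.2); rewrite addrA subrK; lra.
  have := ler_normD (g x - g y) (g x' - g x); have -> : g x - g y + (g x' - g x) = g x' - g y by ring.
  rewrite [`|g x' - g x|]distrC; lra.
have [d d0 Pd] : exists2 d : R, 0 < d & K `<=` P d.
  near (0 : R)^'+ => d; exists d; near: d; [exact: nbhs_right_gt | exact: near0].
have gK x : g x != 0 -> K x by move=> gx; apply: subset_closure.
exists d => // x y xy1 xy2.
have [gx|/gK/Pd] := eqVneq (g x) 0; last exact.
have [gy|/gK/Pd h] := eqVneq (g y) 0; first by rewrite gx gy subrr normr0 ltW.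
by rewrite distrC; apply: h; rewrite distrC.
Unshelve. all: by end_near. Qed.

Lemma compact_support_bounded (R : realType) (g : R * R -> R) :
  compactly_supported g -> exists2 B : R, 0 < B & forall w, g w != 0 ->
    in_window (- B) B w.1 && in_window (- B) B w.2.
Proof.
rewrite /compactly_supported => /compact_bounded[M [Mr hM]].
(* The bound holds for every number above [M], such as |M| + 1; the further 1 makes it strict, as
   the open right end requires. *)
exists (`|M| + 2) => [|w gw]; first by have := normr_ge0 M; lra.
have Mlt : M < `|M| + 1 by have := ler_norm M; lra.
have hw : `|w| <= `|M| + 1 by apply: hM Mlt _ _; apply: subset_closure.
have h1 : `|w.1| <= `|M| + 1 by apply: le_trans hw; rewrite prod_normE le_max lexx.
have h2 : `|w.2| <= `|M| + 1 by apply: le_trans hw; rewrite prod_normE le_max lexx orbT.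
move: h1 h2; rewrite !ler_norml /in_window => /andP[h1 h2] /andP[h3 h4].
by apply/andP; split; apply/andP; split; lra.
Qed.

Definition grid (R : realType) (B : R) (m : nat) (i : nat) : R := - B + i%:R * (2 * B / m%:R).

Definition grid_box (R : realType) (B : R) (m : nat) (i j : nat) : R -> R -> R :=
  box (grid B m i) (grid B m i.+1) (grid B m j) (grid B m j.+1).

Lemma gridS (R : realType) (B : R) m i : grid B m i.+1 = grid B m i + 2 * B / m%:R.
Proof. by rewrite /grid -natr1 mulrDl mul1r addrA. Qed.

Lemma grid_le (R : realType) (B : R) m i : 0 < B -> grid B m i <= grid B m i.+1.
Proof. by move=> B0; rewrite gridS lerDl divr_ge0// mulr_ge0// ltW. Qed.

Lemma sum_grid_box (R : realType) (B : R) m s t : 0 < B -> (0 < m)%N ->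
  \sum_(i < m) \sum_(j < m) grid_box B m i j s t = box (- B) B (- B) B s t.
Proof.
move=> B0 m0; have mR : m%:R != 0 :> R by rewrite pnatr_eq0 -lt0n.
rewrite /grid_box /box -big_distrlr/= !window_telescope; last 2 first.
- by move=> i; exact: grid_le.
- by move=> i; exact: grid_le.
have -> : grid B m 0 = - B by rewrite /grid mul0r addr0.
by have -> : grid B m m = B by rewrite /grid; field.
Qed.

Lemma box_ge0 (R : realType) (b1 b2 c1 c2 s t : R) : 0 <= box b1 b2 c1 c2 s t.
Proof. by rewrite /box mulr_ge0. Qed.

Definition step (R : realType) (g : R * R -> R) (B : R) (m : nat) (s t : R) : R :=
  \sum_(i < m) \sum_(j < m) g (grid B m i, grid B m j) * grid_box B m i j s t.

(** The cells tile a box containing the support, so the difference splits cell by cell. The box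
    indicator stays in the bound so that the error can be integrated over the plane and summed over
    triples. *)
Lemma step_approx (R : realType) (g : R * R -> R) (B om d : R) m : 0 < B -> (0 < m)%N ->
  (forall w, g w != 0 -> in_window (- B) B w.1 && in_window (- B) B w.2) ->
  (forall x y : R * R, `|x.1 - y.1| < d -> `|x.2 - y.2| < d -> `|g x - g y| <= om) ->
  2 * B / m%:R < d -> forall s t,
  `|g (s, t) - step g B m s t|
  <= om * box (- B) B (- B) B s t.
Proof.
move=> B0 m0 gB gd md s t; rewrite /step.
have -> : g (s, t) = \sum_(i < m) \sum_(j < m) g (s, t) * grid_box B m i j s t.
  under eq_bigr do rewrite -mulr_sumr.
  rewrite -mulr_sumr sum_grid_box// /box.
  have [->|/gB/= /andP[-> ->]] := eqVneq (g (s, t)) 0; first by rewrite mul0r.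
  by rewrite !mulr1.
rewrite -(sum_grid_box _ _ B0 m0) mulr_sumr -sumrB.
apply: le_trans (ler_norm_sum _ _ _) _; apply: ler_sum => i _.
rewrite mulr_sumr -sumrB; apply: le_trans (ler_norm_sum _ _ _) _; apply: ler_sum => j _.
rewrite -mulrBl normrM (ger0_norm (box_ge0 _ _ _ _ _ _)).
rewrite /grid_box /box; case: (boolP (in_window _ _ s)) => [|_]; last by rewrite !mul0r !mulr0.
case: (boolP (in_window _ _ t)) => [|_]; last by rewrite !mulr0.
rewrite /in_window !gridS => /andP[t1 t2] /andP[s1 s2].
by rewrite !mulr1; apply: gd => /=; rewrite ger0_norm; lra.
Qed.

Definition has_integral2 (R : realType) (f : R * R -> R) (v : R) : Prop :=
  ((@lebesgue_measure R \x @lebesgue_measure R)%E).-integrable setT (EFin \o f) /\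
  \int[(@lebesgue_measure R \x @lebesgue_measure R)%E]_w f w = v.

Lemma has_integral2_ext (R : realType) (f g : R * R -> R) v :
  f =1 g -> has_integral2 f v -> has_integral2 g v.
Proof. by move=> /funext ->. Qed.

Lemma has_integral2D (R : realType) (f g : R * R -> R) v w :
  has_integral2 f v -> has_integral2 g w -> has_integral2 (fun x => f x + g x) (v + w).
Proof.
move=> [If <-] [Ig <-]; split; first exact: (integrableD measurableT If Ig).
by rewrite RintegralD.
Qed.

Lemma has_integral2Z (R : realType) (f : R * R -> R) v c :
  has_integral2 f v -> has_integral2 (fun x => c * f x) (c * v).
Proof.
move=> [If <-]; split; first exact: (integrableZl measurableT c If).
by rewrite RintegralZl.
Qed.

Lemma has_integral2_sum (R : realType) (I : Type) (r : seq I) (f : I -> R * R -> R) (v : I -> R) :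
  (forall i, has_integral2 (f i) (v i)) ->
  has_integral2 (fun x => \sum_(i <- r) f i x) (\sum_(i <- r) v i).
Proof.
move=> h; elim: r => [|i r IH].
  rewrite big_nil; apply: (@has_integral2_ext _ (fun _ => 0)) => [x|]; first by rewrite big_nil.
  split; first exact: integrable0.
  by rewrite /Rintegral integral0.
rewrite big_cons; apply: has_integral2_ext (has_integral2D (h i) IH) => x.
by rewrite big_cons.
Qed.

Lemma has_integral2_box (R : realType) (b1 b2 c1 c2 : R) : b1 <= b2 -> c1 <= c2 ->
  has_integral2 (fun w => box b1 b2 c1 c2 w.1 w.2) ((b2 - b1) * (c2 - c1)).
Proof.
move=> b12 c12; set mu2 := (@lebesgue_measure R \x @lebesgue_measure R)%E.
pose A : set R := `[b1, b2[%classic; pose C : set R := `[c1, c2[%classic.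
have mA : measurable A by exact: measurable_itv.
have mC : measurable C by exact: measurable_itv.
have mAC : measurable (A `*` C) by exact: measurableX.
have len (x y : R) : x <= y -> @lebesgue_measure R `[x, y[%classic = (y - x)%:E.
  move=> xy; have /= -> := @lebesgue_measure_itv R `[x, y[%R.
  rewrite lte_fin; case: ltP => [_|yx]; first by rewrite EFinB.
  by rewrite (_ : y = x) ?subrr//; apply/eqP; rewrite eq_le xy yx.
have muAC : mu2 (A `*` C) = ((b2 - b1) * (c2 - c1))%:E.
  rewrite /mu2 product_measure1E//.
  by rewrite [X in (X * _)%E](len _ _ b12) [X in (_ * X)%E](len _ _ c12) -EFinM.
have E : (fun w : R * R => box b1 b2 c1 c2 w.1 w.2) = \1_(A `*` C).
  apply/funext => -[s t]; rewrite indicE /box /in_window/=.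
  rewrite in_setX /= !mem_setE/= !in_itv/=.
  by case: (b1 <= s < b2); case: (c1 <= t < c2); rewrite ?mulr1 ?mulr0.
rewrite E; split.
  apply/integrableP; split; first exact/measurable_EFinP/measurable_indic.
  under eq_integral do rewrite /= ger0_norm//.
  by rewrite integral_indic// setIT [X in (X < _)%E]muAC ltry.
by rewrite /Rintegral integral_indic// setIT [X in fine X]muAC.
Qed.

Definition riemann_sum (R : realType) (g : R * R -> R) (B : R) (m : nat) : R :=
  \sum_(i < m) \sum_(j < m) g (grid B m i, grid B m j) * ((2 * B / m%:R) * (2 * B / m%:R)).

Lemma has_integral2_step (R : realType) (g : R * R -> R) (B : R) (m : nat) : 0 < B ->
  has_integral2 (fun w => step g B m w.1 w.2) (riemann_sum g B m).
Proof.
move=> B0; apply: has_integral2_sum => i; apply: has_integral2_sum => j.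
apply: has_integral2Z; rewrite /grid_box.
have E k : 2 * B / m%:R = grid B m k.+1 - grid B m k by rewrite gridS addrAC subrr add0r.
by rewrite {1}(E i) (E j); apply: has_integral2_box; exact: grid_le.
Qed.

(** Measurability for the product sigma-algebra follows because g is a pointwise limit of step
    functions on rectangles; the indicator of a box dominates. *)
Lemma integrable_compact_support (R : realType) (g : R * R -> R) :
  (forall w, 0 <= g w <= 1) -> continuous g -> compactly_supported g ->
  ((@lebesgue_measure R \x @lebesgue_measure R)%E).-integrable setT (EFin \o g).
Proof.
move=> g01 cg sg; have [B B0 gB] := compact_support_bounded sg.
have mg : measurable_fun [set: R * R] g.
  have approx (n : nat) : exists k, forall w, `|g w - step g B k w.1 w.2| <= n.+1%:R^-1.
    have n0 : 0 < n.+1%:R^-1 :> R by rewrite invr_gt0.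
    have [d d0 hd] := unif_continuous_compact_support cg sg n0.
    pose k := (Num.truncn (2 * B / d)).+1; exists k => -[s t].
    have k0 : (0 < k)%N by [].
    have kd : 2 * B / k%:R < d.
      by rewrite ltr_pdivrMr// [ltRHS]mulrC -ltr_pdivrMr// truncnS_gt.
    apply: le_trans (step_approx B0 k0 gB hd kd s t) _.
    rewrite ler_piMr ?(ltW n0)// /box.
    by case: (in_window _ _ s); case: (in_window _ _ t); rewrite ?mulr1 ?mulr0 ?ler01 ?lexx.
  have [m hm] := choice approx.
  apply: (@measurable_fun_cvg _ _ _ _ (fun n w => step g B (m n) w.1 w.2)).
    move=> n; have [/measurable_int/measurable_EFinP//] := has_integral2_step g (m n) B0.
  move=> w _; apply/cvgrPdist_le => eps eps0.
  exists (Num.truncn eps^-1) => // n /= nk; apply: le_trans (hm n w) _.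
  rewrite invf_ple ?posrE// ltW//; apply: lt_le_trans (truncnS_gt _) _.
  by rewrite ler_nat ltnS.
have BB : - B <= B by lra.
have [Ibox _] := has_integral2_box BB BB.
apply: (le_integrable _ _ _ Ibox) => //; first exact/measurable_EFinP.
move=> w _ /=; rewrite lee_fin.
have /andP[g0 g1] := g01 w; rewrite !ger0_norm ?box_ge0//.
have [->|/gB/andP[h1 h2]] := eqVneq (g w) 0; first exact: box_ge0.
by rewrite /box h1 h2 mulr1.
Qed.

Lemma integral_step_approx (R : realType) (g : R * R -> R) (B om : R) (m : nat) : 0 < B ->
  ((@lebesgue_measure R \x @lebesgue_measure R)%E).-integrable setT (EFin \o g) ->
  (forall s t, `|g (s, t) - step g B m s t| <= om * box (- B) B (- B) B s t) ->
  `|\int[(@lebesgue_measure R \x @lebesgue_measure R)%E]_w g w - riemann_sum g B m|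
    <= om * (2 * B) ^+ 2.
Proof.
move=> B0 Ig hg; have [Is <-] := has_integral2_step g m B0.
have BB : - B <= B by lra.
have [Ibox boxE] := has_integral2Z om (has_integral2_box BB BB).
have := has_integral2D (conj Ig erefl) (has_integral2Z (-1) (conj Is erefl)).
rewrite mulN1r => -[Id <-].
apply: le_trans (le_normr_Rintegral measurableT Id) _.
have -> : om * (2 * B) ^+ 2 = om * ((B - - B) * (B - - B)) by ring.
rewrite -boxE; apply: le_Rintegral => //.
  by have := integrable_abse Id.
by move=> [s t] _ /=; rewrite mulN1r.
Qed.

(** * The triple correlation *)

Lemma sum_tuple3 (R : nmodType) (T : finType) (F : 3.-tuple T -> R) :
  \sum_x F x = \sum_a \sum_b \sum_c F [tuple a; b; c].
Proof.
rewrite (pair_bigA _ (fun a b => \sum_c F [tuple a; b; c]))/=.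
rewrite (pair_bigA _ (fun p c => F [tuple p.1; p.2; c]))/=.
rewrite (reindex (fun p : T * T * T => [tuple p.1.1; p.1.2; p.2]))//=.
exists (fun x : 3.-tuple T => (tnth x (@Ordinal 3 0 isT), tnth x (@Ordinal 3 1 isT),
  tnth x (@Ordinal 3 2 isT))).
  by move=> [[a b] c] _.
by move=> [[|a [|b [|c []]]] //= i] _; apply: val_inj.
Qed.

(** Discarding the excluded value 0 from each coordinate leaves the successors of the elements of
    ['I_N], which is the shift built into [point]. *)
Lemma correlation_triple_sum (R : realType) (a L : R) (N : nat) (g : R * R -> R) :
  correlation (k := 3) a L N (fun w => g (w 0 0, w 0 1)) =
  N%:R^-1 * \sum_(y < N) \sum_(x < N) \sum_(z < N)
     [&& x != y, y != z & x != z]%:R *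
     g (N%:R / L * sgn_frac (point a x - point a y), N%:R / L * sgn_frac (point a y - point a z)).
Proof.
rewrite /correlation; congr (_ * _); rewrite big_mkcond/= sum_tuple3.
rewrite [RHS]exchange_big/=.
rewrite [LHS]big_ord_recl/= big1 ?add0r; last first.
  by move=> b _; apply: big1 => c _; rewrite /= andbF.
apply: eq_bigr => x _.
rewrite [LHS]big_ord_recl/= big1 ?add0r; last first.
  by move=> c _; rewrite /= !andbF.
apply: eq_bigr => y _.
rewrite [LHS]big_ord_recl/= !andbF add0r.
apply: eq_bigr => z _; rewrite /= !inE !(inj_eq lift_inj) negb_or !andbT !mxE /= /bump !add1n.
by rewrite -!mulrBr; case: (x == y); case: (x == z); case: (y == z); rewrite /= ?(mul0r, mul1r).
Qed.

Lemma triple_sum_le (R : realType) (a L : R) (N : nat) (f h : R -> R -> R) :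
  (forall s t, `|f s t| <= h s t) -> `|triple_sum a L N f| <= triple_sum a L N h.
Proof.
move=> fh; do 3 (apply: le_trans (ler_norm_sum _ _ _) _; apply: ler_sum => ? _).
exact: fh.
Qed.

Lemma triple_sumB (R : realType) (a L : R) (N : nat) (f h : R -> R -> R) :
  triple_sum a L N f - triple_sum a L N h = triple_sum a L N (fun s t => f s t - h s t).
Proof.
by rewrite /triple_sum -sumrB; apply: eq_bigr => y _; rewrite -sumrB; apply: eq_bigr => x _;
  rewrite -sumrB.
Qed.

Lemma triple_sumZ (R : realType) (a L c : R) (N : nat) (f : R -> R -> R) :
  triple_sum a L N (fun s t => c * f s t) = c * triple_sum a L N f.
Proof.
by rewrite /triple_sum mulr_sumr; apply: eq_bigr => y _; rewrite mulr_sumr; apply: eq_bigr => x _;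
  rewrite mulr_sumr.
Qed.

Lemma triple_sum_sum (R : realType) (a L : R) (N m : nat) (f : 'I_m -> R -> R -> R) :
  triple_sum a L N (fun s t => \sum_i f i s t) = \sum_i triple_sum a L N (f i).
Proof.
rewrite /triple_sum [RHS]exchange_big/=; apply: eq_bigr => y _.
rewrite [RHS]exchange_big/=; apply: eq_bigr => x _.
by rewrite [RHS]exchange_big.
Qed.

Lemma finite_max_threshold (I : finType) (P : I -> nat -> Prop) :
  (forall i, exists N0, forall N, (N0 <= N)%N -> P i N) ->
  exists N0, forall N, (N0 <= N)%N -> forall i, P i N.
Proof.
move=> /choice[f hf]; exists (\max_i f i) => N fN i; apply: hf.
by apply: leq_trans fN; exact: leq_bigmax.
Qed.

Lemma triple_sum_asymp (R : realType) (eps a delta : R) (g : R * R -> R) :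
  0 < eps -> 0 < delta -> good_energy a ->
  (forall w, 0 <= g w <= 1) -> continuous g -> compactly_supported g ->
  exists N0 : nat, forall (N : nat), (N0 <= N)%N -> forall L : R,
    N%:R `^ (4^-1 + eps) < L -> L < N%:R `^ (1 - eps) ->
    `|triple_sum a L N (fun s t => g (s, t))
      - (\int[(@lebesgue_measure R \x @lebesgue_measure R)%E]_w g w) * (N%:R * L ^+ 2)|
      <= delta * (N%:R * L ^+ 2).
Proof.
move=> e0 d0 good g01 cg sg.
have Ig := integrable_compact_support g01 cg sg.
have [B B0 gB] := compact_support_bounded sg.
pose A := (2 * B) ^+ 2; have A0 : 0 < A by rewrite exprn_gt0// mulr_gt0.
(* The step error is paid A + 1 times in the triple sum and [A] times in the integral; both together
   use half of [delta]. *)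
pose om := delta / (2 * (2 * A + 1)).
have om0 : 0 < om by rewrite divr_gt0//; lra.
have [d dd hd] := unif_continuous_compact_support cg sg om0.
pose m := (Num.truncn (2 * B / d)).+1; have m0 : (0 < m)%N by [].
have mR : 0 < m%:R :> R by rewrite ltr0n.
have md : 2 * B / m%:R < d.
  by rewrite ltr_pdivrMr// [ltRHS]mulrC -ltr_pdivrMr// truncnS_gt.
have happ := step_approx B0 m0 gB hd md.
have hint := integral_step_approx B0 Ig happ.
set I := Rintegral _ _ _ in hint *.
(* The other half of [delta] is shared by the m^2 cells, each weighted by a value of g at most 1. *)
pose d1 := delta / (2 * m%:R ^+ 2).
have m20 : 0 < m%:R ^+ 2 :> R by rewrite exprn_gt0.
have d10 : 0 < d1 by rewrite divr_gt0// mulr_gt0.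
pose hh := 2 * B / m%:R.
have dE k : grid B m k.+1 - grid B m k = hh by rewrite gridS addrAC subrr add0r.
pose P (ij : 'I_m * 'I_m) (N : nat) := forall L : R,
  N%:R `^ (4^-1 + eps) < L -> L < N%:R `^ (1 - eps) ->
  `|triple_sum a L N (grid_box B m ij.1 ij.2) - hh * hh * (N%:R * L ^+ 2)| <= d1 * (N%:R * L ^+ 2).
have [N1 hN1] : exists N0, forall N, (N0 <= N)%N -> forall ij, P ij N.
  apply: finite_max_threshold => -[i j].
  have [N0 h] := triple_sum_box_asymp e0 d10 (grid_le m i B0) (grid_le m j B0) good.
  exists N0 => N NN L Llo Lhi; have := h N L NN Llo Lhi.
  by rewrite !dE.
have BB : - B <= B by lra.
have [N2 hN2] := triple_sum_box_asymp e0 ltr01 BB BB good.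
exists (maxn N1 N2) => N; rewrite geq_max => /andP[NN1 NN2] L Llo Lhi.
set M := N%:R * L ^+ 2; have M0 : 0 <= M by rewrite mulr_ge0// sqr_ge0.
set T := triple_sum a L N (fun s t => g (s, t)).
have t1 : `|T - triple_sum a L N (step g B m)| <= om * triple_sum a L N (box (- B) B (- B) B).
  by rewrite triple_sumB -triple_sumZ; apply: triple_sum_le.
have t2 : triple_sum a L N (box (- B) B (- B) B) <= (A + 1) * M.
  have := hN2 N L NN2 Llo Lhi; rewrite -/M ler_norml => /andP[_].
  have -> : (B - - B) * (B - - B) = A by rewrite /A; ring.
  lra.
have t3 : `|triple_sum a L N (step g B m) - riemann_sum g B m * M| <= m%:R ^+ 2 * d1 * M.
  rewrite /step triple_sum_sum /riemann_sum mulr_suml -sumrB.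
  apply: le_trans (ler_norm_sum _ _ _) _.
  apply: (le_trans (y := \sum_(i < m) \sum_(j < m) d1 * M)); last first.
    by rewrite !sumr_const !card_ord -[leLHS]mulr_natl -[X in _ * X]mulr_natl expr2 !mulrA.
  apply: ler_sum => i _; rewrite triple_sum_sum mulr_suml -sumrB.
  apply: le_trans (ler_norm_sum _ _ _) _; apply: ler_sum => j _.
  rewrite triple_sumZ -mulrA -mulrBr normrM.
  have /andP[g0 g1] := g01 (grid B m i, grid B m j).
  rewrite (ger0_norm g0) -[leRHS]mul1r; apply: ler_pM => //.
  exact: (hN1 N NN1 (i, j)).
have t4 : `|riemann_sum g B m * M - I * M| <= om * A * M.
  by rewrite -mulrBl normrM (ger0_norm M0) distrC ler_wpM2r.
have t5 : om * triple_sum a L N (box (- B) B (- B) B) <= om * ((A + 1) * M).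
  by rewrite ler_wpM2l// ltW.
have -> : T - I * M = (T - triple_sum a L N (step g B m))
  + (triple_sum a L N (step g B m) - riemann_sum g B m * M) + (riemann_sum g B m * M - I * M) by ring.
apply: le_trans (ler_normD _ _) _; apply: le_trans (lerD (ler_normD _ _) (lexx _)) _.
have c1 : m%:R ^+ 2 * d1 = delta / 2.
  by rewrite /d1; field; rewrite gt_eqF.
have c2 : om * (2 * A + 1) = delta / 2.
  by rewrite /om; field; rewrite gt_eqF//; lra.
rewrite c1 in t3.
apply: le_trans (lerD (lerD (le_trans t1 t5) t3) t4) _.
have -> : om * ((A + 1) * M) + delta / 2 * M + om * A * M = (om * (2 * A + 1) + delta / 2) * M by ring.
by rewrite c2 ler_wpM2r//; lra.
Qed.

Lemma sum_indicator_eq (R : pzSemiRingType) (I : finType) (i : I) (F : I -> R) :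
  \sum_j (j == i)%:R * F j = F i.
Proof.
rewrite (bigD1 i)//= eqxx mul1r big1 ?addr0// => j /negbTE ->.
by rewrite mul0r.
Qed.

(** The variance bound also controls a first moment: S = 2 B L + E with E <= E^2 + 1/4, and the
    terms linear in L are absorbed by L^2 since L tends to infinity. *)
Lemma pair_sum_small (R : realType) (eps a B delta : R) :
  0 < eps -> 0 < delta -> 0 < B -> good_energy a ->
  exists N0 : nat, forall (N : nat) (L : R), (N0 <= N)%N ->
    N%:R `^ (4^-1 + eps) < L -> L < N%:R `^ (1 - eps) ->
    \sum_(y < N) \sum_(x < N) (in_window (- B) B (N%:R / L * sgn_frac (point a x - point a y)))%:R
      <= delta * (N%:R * L ^+ 2) /\
    \sum_(y < N) \sum_(x < N) (in_window (- B) B (N%:R / L * sgn_frac (point a y - point a x)))%:R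
      <= delta * (N%:R * L ^+ 2).
Proof.
move=> e0 d0 B0 good; have d20 : 0 < delta / 2 by rewrite divr_gt0.
have BB : - B <= B by lra.
have [N1 hN1] := sgn_frac_count e0 d20 BB good.
have [N2 hN2] := @le_powR_eventually R eps (2 * (2 * B + 1) / delta + 1) e0.
exists (maxn N1 N2) => N L; rewrite geq_max => /andP[NN1 NN2] Llo Lhi.
have [N0 hX] := hN2 N NN2; have [XL _] := powR_range e0 N0 Llo Lhi.
have LK := le_lt_trans hX XL.
have K0 : 0 <= 2 * (2 * B + 1) / delta by rewrite divr_ge0 ?(ltW d0)//; lra.
have L1 : 1 <= L by lra.
have dL : 2 * B + 1 <= delta / 2 * L.
  have : 2 * (2 * B + 1) / delta <= L by lra.
  by rewrite ler_pdivrMr//; lra.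
have key (S : 'I_N -> R) : \sum_(y < N) (S y - (B - - B) * L) ^+ 2 <= delta / 2 * (N%:R * L ^+ 2) ->
    \sum_(y < N) S y <= delta * (N%:R * L ^+ 2).
  move=> hS; apply: (le_trans (y := \sum_(y < N) ((delta / 2 * L) * L + (S y - (B - - B) * L) ^+ 2))).
    apply: ler_sum => y _; set E := S y - _.
    have -> : S y = 2 * B * L + E by rewrite /E; ring.
    have : (2 * B + 1) * L <= delta / 2 * L * L by rewrite ler_wpM2r//; lra.
    have := sqr_ge0 (E - 2^-1); nra.
  rewrite big_split/= sumr_const card_ord -[X in X + _]mulr_natl.
  have -> : N%:R * (delta / 2 * L * L) = delta / 2 * (N%:R * L ^+ 2) by ring.
  lra.
have [h1 h2] := hN1 N L NN1 Llo Lhi.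
split.
  apply: le_trans (key _ h1); apply: ler_sum => y _.
  by rewrite natr_card.
by apply: le_trans (key _ h2); apply: ler_sum => y _; rewrite natr_card.
Qed.

Lemma correlation_asymp (R : realType) (eps a delta : R) (g : R * R -> R) :
  0 < eps -> 0 < delta -> good_energy a ->
  (forall w, 0 <= g w <= 1) -> continuous g -> compactly_supported g ->
  exists N0 : nat, forall (N : nat) (L : R), (N0 <= N)%N ->
    N%:R `^ (4^-1 + eps) < L -> L < N%:R `^ (1 - eps) ->
    `|correlation (k := 3) a L N (fun w => g (w 0 0, w 0 1))
      - (\int[(@lebesgue_measure R \x @lebesgue_measure R)%E]_w g w) * L ^+ 2| <= delta * L ^+ 2.
Proof.
move=> e0 d0 good g01 cg sg.
have [B B0 gB] := compact_support_bounded sg.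
(* One quarter for the full triple sum and one for each of the three kinds of coincidence. *)
have d40 : 0 < delta / 4 by rewrite divr_gt0.
have [N1 h1] := triple_sum_asymp e0 d40 good g01 cg sg.
have [N2 h2] := pair_sum_small e0 d40 B0 good.
exists (maxn 1 (maxn N1 N2)) => N L; rewrite !geq_max => /and3P[N0 NN1 NN2] Llo Lhi.
have NR : 0 < N%:R :> R by rewrite ltr0n.
have {h1} := h1 N NN1 L Llo Lhi; have [s1 s2] := h2 N L NN2 Llo Lhi.
rewrite correlation_triple_sum; set M := N%:R * L ^+ 2 in s1 s2 *.
set I := Rintegral _ _ _; set T := triple_sum _ _ _ _ => hT.
set D := \sum_(y < N) _.
pose s (x y : 'I_N) := N%:R / L * sgn_frac (point a x - point a y).
pose b (t : R) : R := (in_window (- B) B t)%:R.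
have gb u v : g (u, v) <= b u /\ g (u, v) <= b v.
  have /andP[g0 g1] := g01 (u, v); rewrite /b.
  have [->|/gB/= /andP[-> ->]//] := eqVneq (g (u, v)) 0.
  by split; case: (in_window _ _ _).
(* For each coincidence, g is bounded through an argument that still involves two distinct index
   variables, so summing out the repeated index leaves a pair sum. *)
have TD : `|T - D| <= \sum_(y < N) \sum_(x < N) \sum_(z < N)
    ((x == y)%:R * b (s y z) + (z == y)%:R * b (s x y) + (z == x)%:R * b (s x y)).
  rewrite /T /D /triple_sum -sumrB; apply: le_trans (ler_norm_sum _ _ _) _; apply: ler_sum => y _.
  rewrite -sumrB; apply: le_trans (ler_norm_sum _ _ _) _; apply: ler_sum => x _.
  rewrite -sumrB; apply: le_trans (ler_norm_sum _ _ _) _; apply: ler_sum => z _.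
  rewrite -/(s x y) -/(s y z) (eq_sym y z) (eq_sym x z).
  have /andP[g0 g1] := g01 (s x y, s y z); have [gs gt] := gb (s x y) (s y z).
  have b1 : 0 <= b (s x y) by []; have b2 : 0 <= b (s y z) by [].
  case: (x == y); case: (z == y); case: (z == x); rewrite /= ?mul0r ?mul1r ?subr0 ?subrr ?normr0 ?ger0_norm//; lra.
have S1 : \sum_(y < N) \sum_(x < N) \sum_(z < N) (x == y)%:R * b (s y z)
    = \sum_(y < N) \sum_(x < N) b (s y x).
  apply: eq_bigr => y _; under eq_bigr do rewrite -mulr_sumr.
  exact: (@sum_indicator_eq R _ y (fun _ => \sum_(z < N) b (s y z))).
have S2 : \sum_(y < N) \sum_(x < N) \sum_(z < N) (z == y)%:R * b (s x y)
    = \sum_(y < N) \sum_(x < N) b (s x y).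
  apply: eq_bigr => y _; apply: eq_bigr => x _.
  exact: (@sum_indicator_eq R _ y (fun _ => b (s x y))).
have S3 : \sum_(y < N) \sum_(x < N) \sum_(z < N) (z == x)%:R * b (s x y)
    = \sum_(y < N) \sum_(x < N) b (s x y).
  apply: eq_bigr => y _; apply: eq_bigr => x _.
  exact: (@sum_indicator_eq R _ x (fun _ => b (s x y))).
have {}TD : `|T - D| <= 3 * (delta / 4 * M).
  apply: le_trans TD _.
  under eq_bigr do (under eq_bigr do rewrite !big_split/=; rewrite !big_split/=).
  rewrite !big_split/= S1 S2 S3.
  have : \sum_(y < N) \sum_(x < N) b (s x y) <= delta / 4 * M by exact: s1.
  have : \sum_(y < N) \sum_(x < N) b (s y x) <= delta / 4 * M by exact: s2.
  lra.
have DM : `|D - I * M| <= delta * M.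
  have -> : D - I * M = (T - I * M) - (T - D) by ring.
  by apply: le_trans (ler_normB _ _) _; lra.
have -> : N%:R^-1 * D - I * L ^+ 2 = N%:R^-1 * (D - I * M).
  by rewrite /M; field; rewrite gt_eqF.
rewrite normrM ger0_norm ?invr_ge0 ?(ltW NR)// ler_pdivrMl//.
by have -> : N%:R * (delta * L ^+ 2) = delta * M by rewrite /M; ring.
Qed.

(** A relative error needs a positive main term. If g is positive at some point, it stays above half
    that value on a small square with that point as its lower left corner. *)
Lemma integral_gt0_or_zero (R : realType) (g : R * R -> R) :
  (forall w, 0 <= g w <= 1) -> continuous g -> compactly_supported g ->
  (forall w, g w = 0) \/ 0 < \int[(@lebesgue_measure R \x @lebesgue_measure R)%E]_w g w.
Proof.
move=> g01 cg sg; have [|] := pselect (forall w, g w = 0); first by left.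
move=> /existsNP[w0 gw0]; right.
have g0 : 0 < g w0 by have /andP[g0 _] := g01 w0; rewrite lt_def g0 andbT; apply/eqP.
have om0 : 0 < g w0 / 2 by rewrite divr_gt0.
have [d d0 hd] := unif_continuous_compact_support cg sg om0.
have [p1 p2] : w0.1 <= w0.1 + d /\ w0.2 <= w0.2 + d by split; lra.
have [Ib bE] := has_integral2Z (g w0 / 2) (has_integral2_box p1 p2).
have Ig := integrable_compact_support g01 cg sg.
apply: (@lt_le_trans _ _ (g w0 / 2 * ((w0.1 + d - w0.1) * (w0.2 + d - w0.2)))).
  by rewrite mulr_gt0// mulr_gt0//; lra.
rewrite -bE; apply: le_Rintegral => // w _ /=.
have /andP[gw _] := g01 w.
rewrite /box; case: (boolP (in_window _ _ w.1)) => [/andP[u1 u2]|_]; last by rewrite mul0r mulr0.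
case: (boolP (in_window _ _ w.2)) => [/andP[v1 v2]|_]; last by rewrite mulr0 mulr0.
rewrite !mulr1.
have : `|g w0 - g w| <= g w0 / 2.
  by apply: hd; rewrite distrC ger0_norm; lra.
by rewrite ler_norml => /andP[]; lra.
Qed.

Unset Implicit Arguments.

Theorem mainTheorem2 (R : realType) (eps : R) (eps_gt0 : 0 < eps) :
  {ae @lebesgue_measure R, forall alpha : R, 0 <= alpha <= 1 ->
    forall g : R * R -> R,
      (forall w, 0 <= g w <= 1) -> continuous g -> compactly_supported g ->
    forall delta : R, 0 < delta ->
    exists N0 : nat, forall (N : nat) (L : R), (N0 <= N)%N ->
      N%:R `^ (4^-1 + eps) < L -> L < N%:R `^ (1 - eps) ->
      exists theta : R, `|theta| <= delta /\
        correlation (k := 3) alpha L N (fun w => g (w 0 0, w 0 1)) =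
        (1 + theta) * L ^+ 2 *
          (\int[(@lebesgue_measure R \x @lebesgue_measure R)%E]_w g w)}.
Proof.
(* The null set is fixed before g and [delta] are introduced. *)
have [A [mA A0 sA]] := ae_total_energy R; exists A; split => // alpha.
move=> bad; apply: sA => goodA; apply: bad => alpha01 g g01 cg sg delta d0.
have good := goodA alpha01.
set I := Rintegral _ _ _.
have [gz|I0] := integral_gt0_or_zero g01 cg sg.
  exists 0%N => N L _ _ _; exists 0; rewrite normr0 (ltW d0); split => //.
  have -> : I = 0 by rewrite /I (_ : g = fun _ => 0); [rewrite /Rintegral integral0|apply/funext].
  rewrite mulr0 /correlation big1 ?mulr0// => x _; exact: gz.
(* An absolute error [delta * I] times L^2 becomes the relative error [delta]. *)
have dI : 0 < delta * I by rewrite mulr_gt0.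
have [N0 hN0] := correlation_asymp eps_gt0 dI good g01 cg sg.
exists N0 => N L NN Llo Lhi; have := hN0 N L NN Llo Lhi.
have L0 : 0 < L by apply: le_lt_trans Llo; exact: powR_ge0.
have L2 : 0 < L ^+ 2 by rewrite exprn_gt0.
rewrite -/I; set C := correlation _ _ _ _ => hC.
exists ((C - I * L ^+ 2) / (I * L ^+ 2)).
have IL : 0 < I * L ^+ 2 by rewrite mulr_gt0.
split; last by field; rewrite !gt_eqF.
rewrite normrM [X in _ * X]ger0_norm ?invr_ge0 ?(ltW IL)// ler_pdivrMr//.
by rewrite [leRHS]mulrA.
Qed.
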